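(* Let $K$ be a field of characteristic $0$, $F(t)=\sum_{n\ge0}a_nt^n\in K[[t]]$ with $a_0=1$, write $\log F(t)=\sum_{n\ge1}b_n\frac{t^n}{n}$, and define $R_n$ by $\sum_{n\ge0}R_nt^n=\prod_{i\ge1}F(x_it)$. Then: (a) $[s_n]R_n=a_n$ for all $n$, i.e. $\sum_{n\ge0}[s_n]R_nt^n=F(t)$. Moreover, for any homogeneous symmetric function $f$ of degree $n$, $[s_n]f$ equals the sum of the coefficients in the $h$-expansion of $f$. (b) $\sum_{n\ge0}[s_{1^n}]R_nt^n=\frac{1}{F(-t)}$. (c) For fixed $k\ge1$, $\sum_{n\ge0}[h_k^n]R_{kn}\,t^n=\exp\left(-\sum_{i\ge1}b_{ki}\frac{(-t)^i}{i}\right)$, i.e. $1/F(-t)$ with each $b_i$ replaced by $b_{ki}$. In particular $[h_n]R_n=b_n$. (d) If $i,j\ge1$ and $i+j=n$, then $[h_ih_j]R_n=b_ib_j-b_n$ if $i\ne j$, and $[h_ih_j]R_n=\frac12(b_i^2-b_n)$ if $i=j$. (e) For $k\ge 0$, $\sum_{n\ge0}R_n(1^k)t^n=F(t)^k$, where $R_n(1^k)$ denotes $R_n$ evaluated at $x_1=\cdots=x_k=1$, $x_{k+1}=x_{k+2}=\cdots=0$. (f) Let $u$ be an indeterminate and write $\frac{F(t)}{F(-ut)}=\sum_{n\ge0}P_n(u)t^n$. Then for $n\ge1$, $P_n(u)$ is a polynomial in $u$ of degree at most $n$ divisible by $1+u$, and $$\frac{P_n(u)}{1+u}=\sum_{k=0}^{n-1}\left([s_{(n-k,1^k)}]R_n\right)u^k,$$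 where $(n-k,1^k)$ denotes the hook partition with one part $n-k$ and $k$ parts equal to $1$.
   Context: For a basis $\{b_\lambda\}$ of symmetric functions, $[b_\lambda]f$ is the coefficient of $b_\lambda$ in the expansion of $f$. $s_\lambda$ are Schur functions, $h_\lambda$ complete homogeneous symmetric functions; $h_k^n$ means $h_{(k,k,\dots,k)}$ with $n$ parts, $s_n=s_{(n)}$, $s_{1^n}=s_{(1,\dots,1)}$. *)

(* Defs.v *)
From mathcomp Require Import all_boot all_order all_algebra.
From mathcomp Require Import mpoly.
From Stdlib Require Import ClassicalEpsilon.

Set Implicit Arguments.
Unset Strict Implicit.
Unset Printing Implicit Defensive.

Import GRing.Theory.
Local Open Scope ring_scope.

(** * Formal power series *)

(* A series sum_n (f n) t^n in A[[t]] is its coefficient sequence f. *)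
Definition fps (A : comNzRingType) := nat -> A.

Section PowerSeries.
Variable A : comNzRingType.
Implicit Types (f g c : fps A).

Definition fps_one : fps A := fun n => (n == 0%N)%:R.
Definition fps_add f g : fps A := fun n => f n + g n.
Definition fps_opp f : fps A := fun n => - f n.
Definition fps_mul f g : fps A := fun n => \sum_(i < n.+1) f i * g (n - i)%N.
Definition fps_pow f k : fps A := iter k (fps_mul f) fps_one.

(* f(z t) *)
Definition fps_dil (z : A) f : fps A := fun n => z ^+ n * f n.

(* sum_m (c m) g(t)^m, for g with zero constant term: as g^m has order >= m,
   only the terms m <= n contribute to t^n. *)
Definition fps_comp c g : fps A :=
  fun n => \sum_(m < n.+1) c m * fps_pow g m n.

(* 1/f = sum_m (1 - f)^m, for f with constant term 1. *)
Definition fps_inv f : fps A :=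
  fps_comp (fun=> 1) (fps_add fps_one (fps_opp f)).

End PowerSeries.

Section ExpLog.
Variable K : fieldType.

(* exp g, for g with zero constant term. *)
Definition fps_exp (g : fps K) : fps K := fps_comp (fun m => (m`!%:R)^-1) g.

(* log f = sum_(m >= 1) (-1)^(m-1) (f - 1)^m / m, for f with constant term 1. *)
Definition fps_log (f : fps K) : fps K :=
  fps_comp (fun m => if m is m'.+1 then (-1) ^+ m' / m%:R else 0)
           (fps_add f (fps_opp (fps_one K))).

(* The series sum_(i >= 1) (b i) t^i / i. *)
Definition fps_logser (b : nat -> K) : fps K :=
  fun i => if i is 0 then 0 else b i / i%:R.

End ExpLog.

(** * Partitions and symmetric functions *)

Definition is_partn (n : nat) (l : seq nat) : bool :=
  [&& sorted geq l, 0%N \notin l & sumn l == n].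

(* The partition (n), which is the empty partition when n = 0. *)
Definition row_partn (n : nat) : seq nat := if n is 0 then [::] else [:: n].

(* The list of all partitions of n: such a partition has at most n parts, all at
   most n. *)
Definition partns (n : nat) : seq (seq nat) :=
  [seq l <- [seq map val t | t : {bseq n of 'I_n.+1}] | is_partn n l].

Lemma partns_uniq n : uniq (partns n).
Proof.
rewrite filter_uniq // map_inj_uniq ?enum_uniq // => s t /inj_map eq_st.
by apply/val_inj/eq_st/val_inj.
Qed.

Lemma mem_partns n l : (l \in partns n) = is_partn n l.
Proof.
rewrite mem_filter; case: (boolP (is_partn n l)) => //= /and3P[_ l0 /eqP suml].
have lt_l k : k \in l -> (k < n.+1)%N.
  move=> kl; rewrite ltnS -suml sumnE (perm_big _ (perm_to_rem kl)) big_cons.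
  exact: leq_addr.
have size_l : (size l <= n)%N.
  rewrite -suml {lt_l suml}; elim: l l0 => //= k l IHl.
  by rewrite inE negb_or eq_sym -lt0n => /andP[k0 /IHl le_l]; rewrite -add1n leq_add.
have size_s : (size [seq inord k : 'I_n.+1 | k <- l] <= n)%N by rewrite size_map.
apply/mapP; exists (Bseq size_s); first exact: mem_enum.
rewrite /= -map_comp map_id_in // => k /lt_l lt_k /=.
by rewrite inordK.
Qed.

Section SymmetricFunctions.
Variable K : fieldType.

(* The ring of symmetric functions is taken as the inverse limit of the rings of
   symmetric polynomials: f N is f(x_1, ..., x_N, 0, 0, ...). *)
Definition varfam := forall N : nat, {mpoly K[N]}.

Definition drop_last_var N (p : {mpoly K[N.+1]}) : {mpoly K[N]} :=
  p \mPo [tuple oapp (fun j : 'I_N => 'X_j) 0 (unlift ord_max i) | i < N.+1].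

Definition homog_symfun (n : nat) (f : varfam) : Prop :=
  [/\ forall N, f N \is symmetric,
      forall N, f N \is n.-homog
    & forall N, drop_last_var (f N.+1) = f N].

(* f(1^k): x_1 = ... = x_k = 1 and x_i = 0 for i > k. *)
Definition eval_ones (k : nat) (f : varfam) : K := (f k).@[fun=> 1].

Definition hsym (k : nat) : varfam :=
  fun N => \sum_(m : 'X_{1..N < k.+1} | mdeg m == k) 'X_[m].

Definition hfun (l : seq nat) : varfam := fun N => \prod_(k <- l) hsym k N.

(* Cells (i, j) of the Young diagram of l: row i, column j, from 0. *)
Definition cell (l : seq nat) : finType :=
  {p : 'I_(size l) * 'I_(head 0%N l) | (p.2 < nth 0%N l p.1)%N}.

Definition is_ssyt (l : seq nat) N (T : {ffun cell l -> 'I_N}) : bool :=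
  [forall p : cell l, forall q : cell l,
     let: (i, j) := val p in let: (i', j') := val q in
     ((i == i') && (j <= j')%N ==> (T p <= T q)%N) &&
     ((j == j') && (i < i')%N ==> (T p < T q)%N)].

Definition schur (l : seq nat) : varfam :=
  fun N => \sum_(T : {ffun cell l -> 'I_N} | is_ssyt T) \prod_(p : cell l) 'X_(T p).

Definition is_expansion (b : seq nat -> varfam) (n : nat) (f : varfam)
    (c : seq nat -> K) : Prop :=
  forall N, f N = \sum_(l <- partns n) c l *: b l N.

(* [b_l] f for f homogeneous of degree n and l a partition of n: the l-th
   coefficient of the expansion of f in (b_m), m ranging over the partitions of
   n. The choice of c is irrelevant when (b_m) is a basis in degree n. *)
Definition bcoef (b : seq nat -> varfam) (n : nat) (f : varfam) (l : seq nat) : K :=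
  epsilon (inhabits (fun=> 0)) (is_expansion b n f) l.

(* R_n, the coefficient of t^n in prod_(i >= 1) F(x_i t). As F(0) = 1, putting
   x_i = 0 for all i > N leaves the product over i <= N, in K[x_1,...,x_N][[t]]. *)
Definition Rfun (F : fps K) (n : nat) : varfam :=
  fun N => (\big[@fps_mul {mpoly K[N]}/fps_one {mpoly K[N]}]_(i < N)
              fps_dil 'X_i (fun m => (F m)%:MP)) n.

End SymmetricFunctions.

(* Main.v *)
(* Write p_k for the power sums and b_n = n [t^n] log F. Since t F'(t) = F(t) sum_k b_k t^k,
   the series sum_n R_n t^n has logarithmic derivative sum_k b_k p_k t^k; for F = 1/(1-t)
   and F = 1+t this concerns the h_n and the e_n. By the fundamental theorem of symmetric
   polynomials the h_l span in each degree, and any prescribed values eta_k of the h_k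
   extend to a ring morphism; it sends p_k to the coefficients pi_k of the logarithmic
   derivative of sum_k eta_k t^k, and hence R_n to those of the series with logarithmic
   derivative sum_k b_k pi_k t^k. Sending sum_k h_k t^k to 1 + t^k gives (c); sending it to
   1 + (t^i + t^j) X and reading off X^2 gives (d).

   For Schur functions, removing the largest entry of a tableau matches the expansion of
   an alternant obtained by column operations, which yields the bialternant formula
   a_delta s_l = a_(l + delta). Hence Schur functions are symmetric and linearly
   independent, and [s_l] f is the coefficient of x^(l + delta) in a_delta f. For f = R_n
   this is the determinant of a_(l_i - i + j), whose first column has two nonzero entries
   when l is a hook; the resulting recursion gives (b) and (f). Part (a) is the
   one-variable case. *)

From HB Require Import structures.
Require Import Defs.
From mathcomp Require Import all_boot all_order all_algebra.
From mathcomp Require Import fingroup perm mpoly boolp zify ring.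
From Stdlib Require Import ClassicalEpsilon.

Set Implicit Arguments.
Unset Strict Implicit.
Unset Printing Implicit Defensive.

Import GRing.Theory.
Local Open Scope ring_scope.

(** * Formal power series *)

Section FpsAlgebra.
Variable A : comNzRingType.
Implicit Types (f g h : fps A) (p q : {poly A}) (n M : nat).

Definition poly_agree M p f := forall n, (n < M)%N -> p`_n = f n.

Lemma poly_agree_trunc M f : poly_agree M (\poly_(i < M) f i) f.
Proof. by move=> n ltnM; rewrite coef_poly ltnM. Qed.

Lemma poly_agreeM M p q f g :
  poly_agree M p f -> poly_agree M q g -> poly_agree M (p * q) (fps_mul f g).
Proof.
move=> pf qg n ltnM; rewrite coefM; apply: eq_bigr => i _.
by have lti := ltn_ord i; rewrite pf ?qg //; lia.
Qed.

Lemma fps_mulC : commutative (@fps_mul A).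
Proof.
move=> f g; apply: funext => n; have agree := @poly_agree_trunc n.+1.
by rewrite -(poly_agreeM (agree f) (agree g)) // mulrC (poly_agreeM (agree g) (agree f)).
Qed.

Lemma fps_mulA : associative (@fps_mul A).
Proof.
move=> f g h; apply: funext => n; have agree := @poly_agree_trunc n.+1.
rewrite -(poly_agreeM (agree f) (poly_agreeM (agree g) (agree h))) // mulrA.
by rewrite (poly_agreeM (poly_agreeM (agree f) (agree g)) (agree h)).
Qed.

Lemma fps_mul1 : left_id (fps_one A) (@fps_mul A).
Proof.
move=> f; apply: funext => n; rewrite /fps_mul big_ord_recl subn0 mul1r.
by rewrite big1 ?addr0 // => i _; rewrite /fps_one mul0r.
Qed.

Lemma fps_mulDl : left_distributive (@fps_mul A) (@fps_add A).
Proof.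
move=> f g h; apply: funext => n; rewrite /fps_add /fps_mul -big_split.
by apply: eq_bigr => i _; rewrite mulrDl.
Qed.

Lemma fps_addA : associative (@fps_add A).
Proof. by move=> f g h; apply: funext => n; apply: addrA. Qed.

Lemma fps_addC : commutative (@fps_add A).
Proof. by move=> f g; apply: funext => n; apply: addrC. Qed.

Lemma fps_add0 : left_id (fun=> 0) (@fps_add A).
Proof. by move=> f; apply: funext => n; apply: add0r. Qed.

Lemma fps_addN : left_inverse (fun=> 0) (@fps_opp A) (@fps_add A).
Proof. by move=> f; apply: funext => n; apply: addNr. Qed.

Lemma fps_one_neq0 : fps_one A <> (fun=> 0).
Proof. by move/(congr1 (@^~ 0%N))/eqP; rewrite /fps_one oner_eq0. Qed.

HB.instance Definition _ := Choice.copy (fps A) (nat -> A).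
HB.instance Definition _ :=
  GRing.isZmodule.Build (fps A) fps_addA fps_addC fps_add0 fps_addN.
HB.instance Definition _ :=
  GRing.Zmodule_isComNzRing.Build (fps A) fps_mulA fps_mulC fps_mul1 fps_mulDl
    (introN eqP fps_one_neq0).

Definition fps_scale (z : A) f : fps A := fun n => z * f n.

Lemma fps_scaleA a b f : fps_scale a (fps_scale b f) = fps_scale (a * b) f.
Proof. by apply: funext => n; apply: mulrA. Qed.

Lemma fps_scale1 : left_id 1 fps_scale.
Proof. by move=> f; apply: funext => n; apply: mul1r. Qed.

Lemma fps_scaleDr : right_distributive fps_scale +%R.
Proof. by move=> a f g; apply: funext => n; apply: mulrDr. Qed.

Lemma fps_scaleDl f : {morph fps_scale^~ f : a b / a + b}.
Proof. by move=> a b; apply: funext => n; apply: mulrDl. Qed.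

HB.instance Definition _ :=
  GRing.Zmodule_isLmodule.Build A (fps A) fps_scaleA fps_scale1 fps_scaleDr fps_scaleDl.

Lemma fps_scaleAl a f g : a *: (f * g) = a *: f * g.
Proof.
by apply: funext => n; rewrite [LHS]mulr_sumr; apply: eq_bigr => i _; rewrite mulrA.
Qed.

HB.instance Definition _ := GRing.Lmodule_isLalgebra.Build A (fps A) fps_scaleAl.
HB.instance Definition _ := GRing.Lalgebra_isComAlgebra.Build A (fps A).

Lemma coef_fpsD f g n : (f + g) n = f n + g n.
Proof. by []. Qed.

Lemma coef_fpsN f n : (- f) n = - f n.
Proof. by []. Qed.

Lemma coef_fpsB f g n : (f - g) n = f n - g n.
Proof. by []. Qed.

Lemma coef_fpsMn f m n : (f *+ m) n = f n *+ m.
Proof. by elim: m => // m IHm; rewrite !mulrS coef_fpsD IHm. Qed.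

Lemma coef_fpsZ a f n : (a *: f) n = a * f n.
Proof. by []. Qed.

Lemma coef_fpsM f g n : (f * g) n = \sum_(i < n.+1) f i * g (n - i)%N.
Proof. by []. Qed.

Lemma coef_fps1 n : (1 : fps A) n = (n == 0%N)%:R.
Proof. by []. Qed.

Lemma coef0_fpsM f g : (f * g) 0%N = f 0%N * g 0%N.
Proof. by rewrite coef_fpsM big_ord1. Qed.

Lemma coef_fps_sum (I : Type) (r : seq I) (P : pred I) (F : I -> fps A) n :
  (\sum_(i <- r | P i) F i) n = \sum_(i <- r | P i) F i n.
Proof. exact: (big_morph (fun f : fps A => f n)). Qed.

Lemma fps_powE f k : fps_pow f k = f ^+ k.
Proof. by elim: k => // k IHk; rewrite exprS -IHk. Qed.

Lemma poly_agree_prod (I : Type) (r : seq I) M (p : I -> {poly A}) (F : I -> fps A) :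
  (forall i, poly_agree M (p i) (F i)) ->
  poly_agree M (\prod_(i <- r) p i) (\prod_(i <- r) F i).
Proof.
move=> agree; elim/big_rec2: _ => [n _|i f q _ agree_qf]; first by rewrite coef1.
exact: poly_agreeM.
Qed.

Lemma coef_fps_prod (I : finType) (F : I -> fps A) n :
  (\prod_i F i) n =
  \sum_(g : {ffun I -> 'I_n.+1} | (\sum_i g i == n)%N) \prod_i F i (g i).
Proof.
have agree i := @poly_agree_trunc n.+1 (F i).
rewrite -(poly_agree_prod _ agree) // (eq_bigr _ (fun i _ => poly_def n.+1 (F i))).
rewrite bigA_distr_bigA coef_sum [RHS]big_mkcond; apply: eq_bigr => g _ /=.
rewrite scaler_prod -expr_sum coefZ coefXn eq_sym.
by case: eqP; rewrite ?mulr1 ?mulr0.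
Qed.

End FpsAlgebra.

Definition fps_map (A B : comNzRingType) (phi : A -> B) (f : fps A) : fps B :=
  fun n => phi (f n).

Section FpsMap.
Variables (A B : comNzRingType) (phi : {rmorphism A -> B}).

Lemma fps_map_is_zmod_morphism : zmod_morphism (fps_map phi).
Proof. by move=> f g; apply: funext => n; apply: rmorphB. Qed.

Lemma fps_map_is_monoid_morphism : monoid_morphism (fps_map phi).
Proof.
split=> [|f g]; apply: funext => n; first by rewrite /fps_map rmorph_nat.
by rewrite [LHS]rmorph_sum; apply: eq_bigr => i _; apply: rmorphM.
Qed.

HB.instance Definition _ :=
  GRing.isZmodMorphism.Build (fps A) (fps B) (fps_map phi) fps_map_is_zmod_morphism.
HB.instance Definition _ :=
  GRing.isMonoidMorphism.Build (fps A) (fps B) (fps_map phi) fps_map_is_monoid_morphism.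

Lemma fps_map_dil z f : fps_map phi (fps_dil z f) = fps_dil (phi z) (fps_map phi f).
Proof. by apply: funext => n; rewrite /fps_map /fps_dil rmorphM rmorphXn. Qed.

End FpsMap.

Section FpsDilation.
Variables (A : comNzRingType) (z : A).

Lemma fps_dil_is_zmod_morphism : zmod_morphism (fps_dil z).
Proof. by move=> f g; apply: funext => n; apply: mulrBr. Qed.

Lemma fps_dil_is_monoid_morphism : monoid_morphism (fps_dil z).
Proof.
split=> [|f g]; apply: funext => n; rewrite /fps_dil.
  by rewrite coef_fps1; case: n => [|n]; rewrite ?mulr0 // mulr1.
rewrite !coef_fpsM mulr_sumr; apply: eq_bigr => i _.
by rewrite mulrACA -exprD subnKC // -ltnS.
Qed.

HB.instance Definition _ :=
  GRing.isZmodMorphism.Build (fps A) (fps A) (fps_dil z) fps_dil_is_zmod_morphism.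
HB.instance Definition _ :=
  GRing.isMonoidMorphism.Build (fps A) (fps A) (fps_dil z) fps_dil_is_monoid_morphism.

Lemma coef0_fps_dil (f : fps A) : fps_dil z f 0%N = f 0%N.
Proof. by rewrite /fps_dil mul1r. Qed.

Lemma fps_dil_dil w (f : fps A) : fps_dil z (fps_dil w f) = fps_dil (z * w) f.
Proof. by apply: funext => n; rewrite /fps_dil mulrA -exprMn. Qed.

End FpsDilation.

Lemma fps_dilN1K (A : comNzRingType) : involutive (fps_dil (-1 : A)).
Proof.
move=> f; rewrite fps_dil_dil mulrNN mulr1; apply: funext => n.
by rewrite /fps_dil expr1n mul1r.
Qed.

Section Composition.
Variables (A : comNzRingType) (g : fps A).
Hypothesis g0 : g 0%N = 0.
Implicit Types (c d f : fps A) (p : {poly A}).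

Lemma coef_fpsM_expr_lt f n M : (n < M)%N -> (f * g ^+ M) n = 0.
Proof.
elim: M f n => // M IHM f n ltnM; rewrite exprS mulrCA coef_fpsM big1 // => i _.
case: (posnP i) => [->|i_gt0]; first by rewrite g0 mul0r.
by rewrite IHM ?mulr0 //; have := ltn_ord i; lia.
Qed.

(* Composition with g agrees in each degree with evaluation of polynomials at g,
   and so inherits its properties. *)
Lemma fps_comp_horner M c p n :
  poly_agree M p c -> (n < M)%N -> fps_comp c g n = horner_alg g p n.
Proof.
move=> agree ltnM; pose q := \poly_(i < n.+1) c i.
have -> : fps_comp c g n = horner_alg g q n.
  rewrite /q poly_def raddf_sum coef_fps_sum; apply: eq_bigr => m _.
  by rewrite /= -mul_polyC rmorphM rmorphXn /= horner_algC horner_algX mulr_algl fps_powE.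
suff -> : p = q + drop_poly n.+1 p * 'X^(n.+1).
  rewrite rmorphD rmorphM rmorphXn /= horner_algX.
  by rewrite coef_fpsD coef_fpsM_expr_lt ?addr0.
rewrite -[LHS](poly_take_drop n.+1); congr (_ + _); apply/polyP => i.
rewrite coef_take_poly coef_poly; case: ifP => // lti.
by rewrite agree // (leq_trans lti).
Qed.

Lemma fps_comp1 : fps_comp (1 : fps A) g = 1.
Proof.
apply: funext => n; rewrite (@fps_comp_horner n.+1 _ 1) ?rmorph1 // => i _.
by rewrite coef1.
Qed.

Lemma fps_compM c d : fps_comp (c * d) g = fps_comp c g * fps_comp d g.
Proof.
apply: funext => n; have agree f := @poly_agree_trunc _ n.+1 f.
rewrite (fps_comp_horner (poly_agreeM (agree c) (agree d))) // rmorphM.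
apply: eq_bigr => i _; rewrite (fps_comp_horner (agree c)) ?ltn_ord //.
by rewrite (fps_comp_horner (agree d)) // ltnS leq_subr.
Qed.

Lemma coef0_fps_comp c : fps_comp c g 0%N = c 0%N.
Proof. by rewrite /fps_comp big_ord1 /= mulr1. Qed.

End Composition.

Section GeometricSeries.
Variable A : comNzRingType.

Definition fps_geom : fps A := fun=> 1.

Definition fps_1D : fps A := fun n => (n <= 1)%:R.

Lemma fps_geomM_1B : fps_geom * fps_dil (-1) fps_1D = 1.
Proof.
apply: funext => -[|n]; first by rewrite coef0_fpsM coef0_fps_dil mulr1.
rewrite coef_fpsM 2!big_ord_recr big1 => [|i _] /=; last first.
  by rewrite /fps_dil /fps_1D (_ : (_ <= 1)%N = false) ?mulr0 //; have := ltn_ord i; lia.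
by rewrite /fps_dil /fps_1D /fps_geom subnn subSnn expr1 !mul1r mulr1 add0r addNr.
Qed.

End GeometricSeries.

Section FpsInverse.
Variable A : comNzRingType.
Implicit Types f g : fps A.

Lemma fps_mulV f : f 0%N = 1 -> f * fps_inv f = 1.
Proof.
move=> f0; rewrite /fps_inv -[fps_add _ _]/(1 - f) -[fun=> 1]/(fps_geom A).
set g := 1 - f; have g0 : g 0%N = 0 by rewrite /g coef_fpsB f0 subrr.
have -> : f = fps_comp (fps_dil (-1) (fps_1D A)) g.
  apply: funext => n; rewrite (@fps_comp_horner _ _ g0 n.+1 _ (1 - 'X)) //.
    by rewrite rmorphB rmorph1 /= horner_algX /g opprB addrC subrK.
  by case=> [|[|i]] _; rewrite coefB coef1 coefX /fps_dil ?mulr0 ?mulr1 ?subr0 ?sub0r.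
by rewrite -fps_compM // mulrC fps_geomM_1B fps_comp1.
Qed.

Lemma coef0_fps_inv f : fps_inv f 0%N = 1.
Proof. by rewrite /fps_inv coef0_fps_comp. Qed.

Lemma fps_inv_unique f g : f 0%N = 1 -> f * g = 1 -> g = fps_inv f.
Proof. by move=> f0 fg1; rewrite -[RHS]mul1r -fg1 mulrAC fps_mulV // mul1r. Qed.

End FpsInverse.

Lemma rmorph_fps_inv (A B : comNzRingType) (phi : {rmorphism fps A -> fps B}) f :
  f 0%N = 1 -> phi f 0%N = 1 -> phi (fps_inv f) = fps_inv (phi f).
Proof. by move=> f0 phif0; apply: fps_inv_unique; rewrite // -rmorphM fps_mulV ?rmorph1. Qed.

Lemma fps_inv_dilN1K (A : comNzRingType) (f : fps A) : f 0%N = 1 ->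
  fps_inv (fps_dil (-1) (fps_inv (fps_dil (-1) f))) = f.
Proof.
move=> f0; apply/esym/fps_inv_unique; first by rewrite coef0_fps_dil coef0_fps_inv.
rewrite -[X in _ * X]fps_dilN1K -rmorphM mulrC fps_mulV ?rmorph1 //.
by rewrite coef0_fps_dil.
Qed.

Section FpsDerivation.
Variable A : comNzRingType.
Implicit Types (c d f g : fps A) (p : {poly A}).

Definition fps_theta f : fps A := fun n => n%:R * f n.

Lemma fps_theta_is_zmod_morphism : zmod_morphism fps_theta.
Proof. by move=> f g; apply: funext => n; apply: mulrBr. Qed.

HB.instance Definition _ :=
  GRing.isZmodMorphism.Build (fps A) (fps A) fps_theta fps_theta_is_zmod_morphism.

Lemma fps_thetaM f g : fps_theta (f * g) = fps_theta f * g + f * fps_theta g.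
Proof.
apply: funext => n; rewrite coef_fpsD !coef_fpsM [LHS]mulr_sumr -big_split.
apply: eq_bigr => i _ /=; have -> : n%:R = i%:R + (n - i)%:R :> A.
  by rewrite -natrD subnKC // -ltnS.
by rewrite /fps_theta; ring.
Qed.

Lemma fps_theta1 : fps_theta 1 = 0.
Proof. by apply: funext => -[|n]; [apply: mul0r|apply: mulr0]. Qed.

Lemma fps_theta_dil z f : fps_theta (fps_dil z f) = fps_dil z (fps_theta f).
Proof. by apply: funext => n; apply: mulrCA. Qed.

Definition fps_deriv c : fps A := fun n => n.+1%:R * c n.+1.

Lemma fps_theta_horner_alg g p :
  fps_theta (horner_alg g p) = horner_alg g p^`() * fps_theta g.
Proof.
elim/poly_ind: p => [|p a IHp]; first by rewrite deriv0 !rmorph0 mul0r raddf0.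
have theta_const : fps_theta (a *: 1) = 0.
  by apply: funext => n; rewrite [LHS]mulrCA [n%:R * _](congr1 (@^~ n) fps_theta1) mulr0.
rewrite derivD derivC addr0 derivM derivX mulr1 !rmorphD !rmorphM /= horner_algX horner_algC.
by rewrite raddfD /= theta_const addr0 fps_thetaM IHp; ring.
Qed.

Lemma fps_theta_comp c g :
  g 0%N = 0 -> fps_theta (fps_comp c g) = fps_comp (fps_deriv c) g * fps_theta g.
Proof.
move=> g0; apply: funext => n; have agree := @poly_agree_trunc _ n.+2 c.
have agree' : poly_agree n.+1 (\poly_(i < n.+2) c i)^`() (fps_deriv c).
  by move=> i lti; rewrite coef_deriv agree // /fps_deriv mulr_natl.
rewrite {1}/fps_theta (fps_comp_horner g0 agree) // -[LHS]/(fps_theta _ n).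
rewrite fps_theta_horner_alg; apply: eq_bigr => i _.
by rewrite (fps_comp_horner g0 agree').
Qed.

Definition fps_logder f c := fps_theta f = c * f.

Lemma fps_logderM f g c d :
  fps_logder f c -> fps_logder g d -> fps_logder (f * g) (c + d).
Proof. by move=> fc gd; rewrite /fps_logder fps_thetaM fc gd; ring. Qed.

Lemma fps_logder_prod (I : Type) (r : seq I) (F C : I -> fps A) :
  (forall i, fps_logder (F i) (C i)) ->
  fps_logder (\prod_(i <- r) F i) (\sum_(i <- r) C i).
Proof.
move=> FC; elim/big_rec2: _ => [|i c f _ fc]; last exact: fps_logderM.
by rewrite /fps_logder fps_theta1 mul0r.
Qed.

Lemma fps_logder_dil z f c : fps_logder f c -> fps_logder (fps_dil z f) (fps_dil z c).
Proof. by move=> fc; rewrite /fps_logder fps_theta_dil fc rmorphM. Qed.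

Lemma fps_logderE f c : f 0%N = 1 -> fps_logder f c -> c = fps_theta f * fps_inv f.
Proof. by move=> f0 ->; rewrite -mulrA fps_mulV ?mulr1. Qed.

Lemma fps_logder_inv f c : f 0%N = 1 -> fps_logder f c -> fps_logder (fps_inv f) (- c).
Proof.
move=> f0 fc; have := congr1 fps_theta (fps_mulV f0).
rewrite fps_thetaM fps_theta1 fc -mulrA fps_mulV // mulr1 => /eqP.
by rewrite addr_eq0 => /eqP ->; rewrite /fps_logder opprK mulrAC fps_mulV // mul1r.
Qed.

End FpsDerivation.

Lemma fps_logder_map (A B : comNzRingType) (phi : {rmorphism A -> B}) f c :
  fps_logder f c -> fps_logder (fps_map phi f) (fps_map phi c).
Proof.
move=> fc; rewrite /fps_logder -rmorphM /= -fc.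
by apply: funext => n; rewrite /fps_map /fps_theta rmorphM rmorph_nat.
Qed.

Section GeometricLogder.
Variable A : comNzRingType.

Definition fps_tgeom : fps A := fun n => (n != 0%N)%:R.

Lemma fps_logder_geom : fps_logder (fps_geom A) fps_tgeom.
Proof.
apply: funext => n; rewrite coef_fpsM big_ord_recl mul0r add0r.
rewrite (eq_bigr (fun=> 1)) => [|i _]; last exact: mulr1.
by rewrite sumr_const card_ord /fps_theta mulr1.
Qed.

Lemma fps_logder_1D : fps_logder (fps_1D A) (fps_dil (-1) (- fps_tgeom)).
Proof.
rewrite -[X in fps_logder X]fps_dilN1K; apply: fps_logder_dil.
rewrite (fps_inv_unique (f := fps_geom A) erefl (fps_geomM_1B A)).
exact: fps_logder_inv erefl fps_logder_geom.
Qed.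

End GeometricLogder.

Section FpsEqMod.
Variable A : comNzRingType.
Implicit Types (c d f g : fps A).

Definition fps_eqmod M f g := forall n, (n < M)%N -> f n = g n.

Lemma fps_eqmodM M f f' g g' :
  fps_eqmod M f f' -> fps_eqmod M g g' -> fps_eqmod M (f * g) (f' * g').
Proof.
move=> ff' gg' n ltnM; apply: eq_bigr => i _; have lti := ltn_ord i.
by rewrite ff' ?gg' //; lia.
Qed.

Lemma fps_eqmod_theta M f g : fps_eqmod M f g -> fps_eqmod M (fps_theta f) (fps_theta g).
Proof. by move=> fg n ltnM; rewrite /fps_theta fg. Qed.

Lemma fps_eqmod_inv M f g :
  f 0%N = 1 -> g 0%N = 1 -> fps_eqmod M f g -> fps_eqmod M (fps_inv f) (fps_inv g).
Proof.
move=> f0 g0 fg n ltnM.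
transitivity ((fps_inv f * (g * fps_inv g)) n); first by rewrite fps_mulV ?mulr1.
transitivity ((fps_inv f * (f * fps_inv g)) n).
  by do 2![apply: (@fps_eqmodM M) => //] => m /fg.
by rewrite mulrA [_ * f]mulrC fps_mulV ?mul1r.
Qed.

Lemma fps_eqmod_logder M f g c d : f 0%N = 1 -> g 0%N = 1 ->
  fps_logder f c -> fps_logder g d -> fps_eqmod M f g -> fps_eqmod M c d.
Proof.
move=> f0 g0 /(fps_logderE f0)-> /(fps_logderE g0)-> fg.
by apply: fps_eqmodM; [apply: fps_eqmod_theta|apply: fps_eqmod_inv].
Qed.

Hypothesis natS_lreg : forall n, GRing.lreg (n.+1%:R : A).

Lemma fps_eqmod_of_logder M f g c d : f 0%N = 1 -> g 0%N = 1 ->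
  fps_logder f c -> fps_logder g d -> fps_eqmod M c d -> fps_eqmod M f g.
Proof.
move=> f0 g0 fc gd cd; pose h := f * fps_inv g.
have theta_h : fps_eqmod M (fps_theta h) 0.
  rewrite (fps_logderM fc (fps_logder_inv g0 gd)) -(mul0r h); apply: fps_eqmodM => // m /cd cdm.
  by rewrite coef_fpsB cdm subrr.
have h1 : fps_eqmod M h 1.
  case=> [_|n ltnM]; first by rewrite /h coef0_fpsM coef0_fps_inv f0 mulr1.
  by apply: (@natS_lreg n); rewrite [LHS]theta_h // coef_fps1 mulr0.
have -> : f = h * g by rewrite /h mulrAC -mulrA fps_mulV ?mulr1.
by rewrite -[X in fps_eqmod _ _ X]mul1r; apply: fps_eqmodM.
Qed.

Lemma fps_logder_unique f g c : f 0%N = 1 -> g 0%N = 1 ->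
  fps_logder f c -> fps_logder g c -> f = g.
Proof.
move=> f0 g0 fc gc; apply: funext => n.
exact: (fps_eqmod_of_logder (M := n.+1) f0 g0 fc gc).
Qed.

Lemma fps_theta_inj f g : f 0%N = g 0%N -> fps_theta f = fps_theta g -> f = g.
Proof.
move=> fg0 theta_fg; apply: funext => -[//|n].
by apply: (@natS_lreg n); apply: (congr1 (@^~ n.+1) theta_fg).
Qed.

End FpsEqMod.

Section CharacteristicZero.
Variables (K : fieldType) (A : comNzRingType) (iota : {rmorphism K -> A}).
Hypothesis charK0 : [pchar K] =i pred0.
Implicit Types g : fps A.

Lemma natS_neq0 n : n.+1%:R != 0 :> K.
Proof. by rewrite ((pcharf0P K).1 charK0). Qed.

Lemma natS_lreg n : GRing.lreg (n.+1%:R : A).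
Proof.
move=> x y /(congr1 ( *%R (iota n.+1%:R^-1))); rewrite -(rmorph_nat iota) !mulrA.
by rewrite -rmorphM mulVf ?natS_neq0 // rmorph1 !mul1r.
Qed.

Lemma fps_logder_comp_exp g : g 0%N = 0 ->
  fps_logder (fps_comp (fun m => iota m`!%:R^-1) g) (fps_theta g).
Proof.
move=> g0; rewrite /fps_logder fps_theta_comp // mulrC; congr (_ * fps_comp _ g).
apply: funext => m; rewrite /fps_deriv -(rmorph_nat iota) -rmorphM factS natrM invfM.
by rewrite mulVKf ?natS_neq0.
Qed.

Lemma fps_logder_exists c : c 0%N = 0 -> exists2 f : fps A, f 0%N = 1 & fps_logder f c.
Proof.
move=> c0; pose g : fps A := fun n => iota n%:R^-1 * c n.
have g0 : g 0%N = 0 by rewrite /g c0 mulr0.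
exists (fps_comp (fun m => iota m`!%:R^-1) g); first by rewrite coef0_fps_comp invr1 rmorph1.
have -> : c = fps_theta g; last exact: fps_logder_comp_exp.
apply: funext => -[|n]; first by rewrite c0 /fps_theta mul0r.
by rewrite /fps_theta mulrA -(rmorph_nat iota) -rmorphM divff ?natS_neq0 // rmorph1 mul1r.
Qed.

End CharacteristicZero.

Section ExpLog.
Variable K : fieldType.
Hypothesis charK0 : [pchar K] =i pred0.
Implicit Types f g : fps K.

Lemma coef0_fps_exp g : fps_exp g 0%N = 1.
Proof. by rewrite /fps_exp coef0_fps_comp invr1. Qed.

Lemma coef1_fps_exp g : fps_exp g 1%N = g 1%N.
Proof.
rewrite /fps_exp /fps_comp !big_ord_recl big_ord0 !fps_powE expr0 coef_fps1.
by rewrite mulr0 add0r addr0 invr1 mul1r expr1.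
Qed.

Lemma fps_logder_exp g : g 0%N = 0 -> fps_logder (fps_exp g) (fps_theta g).
Proof. exact: (fps_logder_comp_exp idfun charK0). Qed.

Lemma fps_logder_log f : f 0%N = 1 -> fps_logder f (fps_theta (fps_log f)).
Proof.
move=> f0; rewrite /fps_logder /fps_log -[fps_add _ _]/(f - 1).
have g0 : (f - 1) 0%N = 0 by rewrite coef_fpsB f0 subrr.
rewrite fps_theta_comp // raddfB /= fps_theta1 subr0 mulrAC.
set inv_f := fps_comp _ _; suff -> : inv_f = fps_inv f by rewrite [_ * f]mulrC fps_mulV ?mul1r.
rewrite /inv_f /fps_inv -[fps_add _ _]/(1 - f); apply: funext => n.
apply: eq_bigr => m _; rewrite /fps_deriv [m.+1%:R * _]mulrC divfK ?natS_neq0 // !fps_powE.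
by rewrite -[f - 1]opprB -scaleN1r exprZn coef_fpsZ mulrA -exprMn mulrNN mulr1 expr1n mul1r.
Qed.

Lemma fps_inv_dil_exp g : g 0%N = 0 ->
  fps_inv (fps_dil (-1) (fps_exp g)) = fps_exp (- fps_dil (-1) g).
Proof.
move=> g0; have dil0 : fps_dil (-1) (fps_exp g) 0%N = 1 by rewrite coef0_fps_dil coef0_fps_exp.
have Ng0 : (- fps_dil (-1) g) 0%N = 0 by rewrite coef_fpsN coef0_fps_dil g0 oppr0.
apply: (fps_logder_unique (natS_lreg idfun charK0) (coef0_fps_inv _) (coef0_fps_exp _)).
  exact: fps_logder_inv dil0 (fps_logder_dil _ (fps_logder_exp g0)).
by have := fps_logder_exp Ng0; rewrite raddfN /= fps_theta_dil.
Qed.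

End ExpLog.

Section Hadamard.
Variable A : comNzRingType.
Implicit Types u v : fps A.

Definition fps_hadamard u v : fps A := fun n => u n * v n.

Lemma fps_theta_hadamard u v : fps_theta (fps_hadamard u v) = fps_hadamard u (fps_theta v).
Proof. by apply: funext => n; apply: mulrCA. Qed.

Lemma fps_hadamard_is_linear u : linear (fps_hadamard u).
Proof.
move=> z v w; apply: funext => n; rewrite [LHS]mulrDr; congr (_ + _).
exact: mulrCA.
Qed.

HB.instance Definition _ u :=
  GRing.isLinear.Build A (fps A) (fps A) *:%R (fps_hadamard u) (fps_hadamard_is_linear u).

End Hadamard.

Section MonomialSubstitution.
Variable A : comNzRingType.
Implicit Types f : fps A.

Definition fps_mono (k : nat) : fps A := fun n => (n == k)%:R.

Lemma fps_monoM i j : fps_mono i * fps_mono j = fps_mono (i + j).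
Proof.
apply: funext => n; rewrite coef_fpsM /fps_mono.
under eq_bigr => m _ do rewrite -natrM mulnb.
case: (leqP i n) => [lein|ltni].
  rewrite (bigD1 (inord i)) //= inordK // eqxx big1 ?addr0 => [|m neq].
    by rewrite -(eqn_add2l i) subnKC.
  by case: eqP => // mi; case/eqP: neq; apply: ord_inj; rewrite inordK.
rewrite big1 => [|m _]; first by rewrite (_ : (n == _) = false) //; lia.
by rewrite (_ : (_ == i) = false) //; have := ltn_ord m; lia.
Qed.

Lemma fps_monoX k m : fps_mono k ^+ m = fps_mono (k * m).
Proof.
elim: m => [|m IHm]; first by rewrite expr0 muln0.
by rewrite exprS IHm fps_monoM mulnS.
Qed.

Lemma coef_fps_comp_monoE f k n :
  fps_comp f (fps_mono k) n = \sum_(m < n.+1) f m * (n == k * m)%N%:R.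
Proof. by apply: eq_bigr => m _; rewrite fps_powE fps_monoX. Qed.

Lemma coef_fps_comp_mono_mul f k n : (0 < k)%N -> fps_comp f (fps_mono k) (k * n)%N = f n.
Proof.
move=> k_gt0; rewrite coef_fps_comp_monoE.
have ltn_kn : (n < (k * n).+1)%N by rewrite ltnS leq_pmull.
rewrite (bigD1 (Ordinal ltn_kn)) //= eqxx mulr1 big1 ?addr0 // => m neq.
by rewrite eqn_pmul2l // eq_sym [_ == n](negPf neq) mulr0.
Qed.

Lemma coef_fps_comp_1D_mono k n : (0 < k)%N ->
  fps_comp (fps_1D A) (fps_mono k) n = ((n == 0%N) || (n == k))%:R.
Proof.
rewrite coef_fps_comp_monoE => k_gt0; case: n => [|n].
  by rewrite big_ord1 muln0 eqxx mulr1.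
rewrite !big_ord_recl big1 => [|m _]; last by rewrite mul0r.
by rewrite muln0 mulr0 add0r addr0 mul1r muln1.
Qed.

Lemma fps_hadamard_mono u k : fps_hadamard u (fps_mono k) = u k *: fps_mono k.
Proof.
apply: funext => n; rewrite coef_fpsZ /fps_hadamard /fps_mono.
by case: eqP => [->|]; rewrite ?mulr0.
Qed.

Lemma fps_hadamard_comp_mono u f k :
  fps_hadamard u (fps_comp f (fps_mono k)) =
  fps_comp (fps_hadamard (fun m => u (k * m)%N) f) (fps_mono k).
Proof.
apply: funext => n; rewrite /fps_hadamard !coef_fps_comp_monoE mulr_sumr.
apply: eq_bigr => m _; case: eqP => [nE|_]; last by rewrite !mulr0.
by rewrite [in u n]nE; ring.
Qed.

Lemma fps_theta_comp_mono f k :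
  fps_theta (fps_comp f (fps_mono k)) = k%:R *: fps_comp (fps_theta f) (fps_mono k).
Proof.
apply: funext => n; rewrite coef_fpsZ /fps_theta !coef_fps_comp_monoE !mulr_sumr.
apply: eq_bigr => m _; case: eqP => [nE|_]; last by rewrite !mulr0.
by rewrite [in n%:R]nE natrM; ring.
Qed.

Lemma fps_logder_comp_mono f c k : (0 < k)%N -> fps_logder f c ->
  fps_logder (fps_comp f (fps_mono k)) (k%:R *: fps_comp c (fps_mono k)).
Proof.
move=> k_gt0 fc; have mono0 : fps_mono k 0%N = 0 by rewrite /fps_mono ltn_eqF.
by rewrite /fps_logder fps_theta_comp_mono fc fps_compM // scalerAl.
Qed.

End MonomialSubstitution.

Section Shift.
Variable A : comNzRingType.
Implicit Types f : fps A.

Definition fps_shift m f : fps A := fun n => if (m <= n)%N then f (n - m)%N else 0.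

Lemma fps_shift0 f n : fps_shift 0 f n = f n.
Proof. by rewrite /fps_shift subn0. Qed.

Lemma fps_shiftSS m f n : fps_shift m.+1 f n.+1 = fps_shift m f n.
Proof. by []. Qed.

End Shift.

Section PolynomialCoefficients.
Variable A : comNzRingType.
Implicit Types (f : fps {poly A}) (q u v : fps A).

Definition fps_Xcoef s f : fps A := fun n => (f n)`_s.

Lemma fps_XcoefM s f g :
  fps_Xcoef s (f * g) = \sum_(t < s.+1) fps_Xcoef t f * fps_Xcoef (s - t) g.
Proof.
apply: funext => n; rewrite coef_fps_sum /fps_Xcoef coef_fpsM coef_sum.
under eq_bigr do rewrite coefM.
exact: exchange_big.
Qed.

Lemma fps_theta_Xcoef s f : fps_Xcoef s (fps_theta f) = fps_theta (fps_Xcoef s f).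
Proof. by apply: funext => n; rewrite /fps_Xcoef /fps_theta !mulr_natl coefMn. Qed.

Lemma fps_Xcoef_hadamard s u f :
  fps_Xcoef s (fps_hadamard (fps_map polyC u) f) = fps_hadamard u (fps_Xcoef s f).
Proof. by apply: funext => n; rewrite /fps_Xcoef coefCM. Qed.

Definition fps_1DX q : fps {poly A} := fun n => (n == 0%N)%:R + q n *: 'X.

Lemma fps_Xcoef_1DX q s :
  fps_Xcoef s (fps_1DX q) = if s == 0%N then 1 else if s == 1%N then q else 0.
Proof.
apply: funext => n; rewrite /fps_Xcoef coefD coefZ coefX -polyC_natr coefC.
by case: s => [|[|s]]; rewrite /= ?mulr0 ?addr0 ?mulr1 ?add0r.
Qed.

Lemma Xcoef_logder_1DX q pi : fps_logder (fps_1DX q) pi ->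
  [/\ fps_Xcoef 0 pi = 0, fps_Xcoef 1 pi = fps_theta q
    & fps_Xcoef 2 pi = - (q * fps_theta q)].
Proof.
move=> logpi; have coefE s := congr1 (fps_Xcoef s) logpi.
have := coefE 0%N; have := coefE 1%N; have := coefE 2%N.
rewrite !fps_theta_Xcoef !fps_XcoefM !fps_Xcoef_1DX /= !big_ord_recl !big_ord0 /=.
rewrite !fps_Xcoef_1DX /= !raddf0 fps_theta1 !mulr1 !addr0 !mulr0 => pi2 pi1 pi0.
rewrite -pi0 !mul0r !add0r in pi1 pi2 *.
by rewrite -pi1 in pi2 *; split=> //; apply/eqP; rewrite -addr_eq0 addrC mulrC -pi2.
Qed.

End PolynomialCoefficients.

(** * Partitions *)

Section Partitions.
Implicit Types (l : seq nat) (i j k m n : nat).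

Lemma nth_sorted_geq l i j : sorted geq l -> (i <= j)%N -> (nth 0 l j <= nth 0 l i)%N.
Proof.
move=> sortl leij; case: (ltnP j (size l)) => [ltj|le]; last by rewrite nth_default.
have geq_trans : transitive geq by move=> m n p /[swap]; apply: leq_trans.
by apply: (sorted_leq_nth geq_trans leqnn 0%N sortl); rewrite ?inE ?(leq_ltn_trans leij).
Qed.

Lemma is_partn_row n : is_partn n (row_partn n).
Proof. by case: n => [|n] //=; rewrite /is_partn /= addn0 eqxx. Qed.

Lemma is_partn_two i j : (0 < i)%N -> (0 < j)%N ->
  is_partn (i + j) [:: maxn i j; minn i j].
Proof. by rewrite /is_partn /= !inE /geq /=; lia. Qed.

Lemma path_geq_nseq m k i : (k <= m)%N -> path geq m (nseq i k).
Proof. by elim: i m => //= i IHi m lekm; rewrite /geq /= lekm IHi. Qed.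

Lemma is_partn_hook n k : (k < n)%N -> is_partn n ((n - k)%N :: nseq k 1%N).
Proof.
move=> ltkn; rewrite /is_partn /= path_geq_nseq ?subn_gt0 // inE negb_or mem_nseq andbF.
by rewrite eq_sym -lt0n subn_gt0 ltkn sumn_nseq mul1n subnK ?eqxx // ltnW.
Qed.

Lemma is_partn_nseq n k : (0 < k)%N -> is_partn (k * n) (nseq n k).
Proof.
move=> k_gt0; rewrite /is_partn sumn_nseq eqxx andbT mem_nseq (ltn_eqF k_gt0) !andbF andbT.
by case: n => //= n; apply: path_geq_nseq.
Qed.

Lemma all_pred1_partn n k l : (0 < k)%N -> is_partn (k * n) l ->
  all (pred1 k) l = (l == nseq n k).
Proof.
move=> k_gt0 /and3P[_ _ /eqP suml]; apply/all_pred1P/eqP => [lE|->]; last by rewrite size_nseq.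
move: suml; rewrite {1}lE sumn_nseq => /eqP; rewrite eqn_pmul2l // => /eqP size_l.
by rewrite lE size_l.
Qed.

Lemma is_partn_sort_cat m n l l' : is_partn m l -> is_partn n l' ->
  is_partn (m + n) (sort geq (l ++ l')).
Proof.
move=> /and3P[_ l0 /eqP suml] /and3P[_ l0' /eqP suml']; apply/and3P; split.
- by apply: sort_sorted => x y; apply: leq_total.
- by rewrite mem_sort mem_cat negb_or l0.
by rewrite (perm_sumn (permEl (perm_sort _ _))) sumn_cat suml suml'.
Qed.

Lemma size_partn_le n l : is_partn n l -> (size l <= n)%N.
Proof.
case/and3P=> _ l0 /eqP <-; elim: l l0 => //= k l IHl.
by rewrite inE negb_or eq_sym -lt0n => /andP[k_gt0 /IHl size_l]; lia.
Qed.

Lemma size_partn_le1 n l : is_partn n l -> (size l <= 1)%N = (l == row_partn n).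
Proof.
case/and3P=> _ l0 /eqP <-; case: l l0 => [|[|k] [|j l]] //= _; rewrite ?addn0 ?eqxx //.
by rewrite addSn eqseq_cons andbF.
Qed.

Lemma partn_eq_nth l l' : 0%N \notin l -> 0%N \notin l' ->
  (forall i, nth 0%N l i = nth 0%N l' i) -> l = l'.
Proof.
have size_le s s' : 0%N \notin s -> (forall i, nth 0%N s i = nth 0%N s' i) ->
    (size s <= size s')%N.
  move=> s0 eqs; rewrite leqNgt; apply/negP => /(mem_nth 0%N).
  by rewrite eqs nth_default // (negPf s0).
move=> l0 l0' eql; apply: (eq_from_nth (x0 := 0%N)) => // ; apply/eqP.
by rewrite eqn_leq !size_le.
Qed.

Lemma sum_partns_delta (R : pzRingType) n l0 (F : seq nat -> R) (D : seq nat -> R) :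
    is_partn n l0 -> (forall l, is_partn n l -> D l = (l == l0)%:R) ->
  \sum_(l <- partns n) F l * D l = F l0.
Proof.
move=> l0_part DE; rewrite (bigD1_seq l0) ?partns_uniq ?mem_partns //=.
rewrite big_seq_cond big1 => [|l].
  by rewrite addr0 DE // eqxx mulr1.
by rewrite mem_partns => /andP[/DE-> /negPf->]; rewrite mulr0.
Qed.

End Partitions.

(** * The symmetric functions R_n *)

Section RGeneratingFunction.
Variable K : fieldType.
Implicit Types (a b : fps K) (N n : nat).

Definition Rgf a N : fps {mpoly K[N]} := fun n => Rfun a n N.

Lemma RgfE a N : Rgf a N = \prod_(i < N) fps_dil 'X_i (fps_map (@mpolyC N K) a).
Proof. by []. Qed.

Lemma RgfM a b N : Rgf (a * b) N = Rgf a N * Rgf b N.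
Proof. by rewrite !RgfE -big_split; apply: eq_bigr => i _; rewrite !rmorphM. Qed.

Lemma Rgf1 N : Rgf 1 N = 1.
Proof. by rewrite RgfE big1 // => i _; rewrite !rmorph1. Qed.

Lemma Rgf_dil z a N : Rgf (fps_dil z a) N = fps_dil z%:MP (Rgf a N).
Proof.
rewrite !RgfE rmorph_prod; apply: eq_bigr => i _.
by rewrite fps_map_dil /= !fps_dil_dil mulrC.
Qed.

Lemma mcoeff_Rfun a n N (m : 'X_{1..N}) :
  (Rfun a n N)@_m = if mdeg m == n then \prod_i a (m i) else 0.
Proof.
pose mg (g : {ffun 'I_N -> 'I_n.+1}) := [multinom g i : nat | i < N].
have termE (g : {ffun 'I_N -> 'I_n.+1}) :
    (\prod_i fps_dil 'X_i (fps_map (@mpolyC N K) a) (g i))@_m =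
    if mg g == m then \prod_i a (m i) else 0.
  rewrite big_split -rmorph_prod /= mulrC mcoeffCM.
  have -> : \prod_i 'X_i ^+ g i = 'X_[mg g] :> {mpoly K[N]}.
    by rewrite [RHS]mpolyXE_id; apply: eq_bigr => i _; rewrite mnmE.
  rewrite mcoeffX; case: eqP => [<-|_]; last by rewrite mulr0.
  by rewrite mulr1; apply: eq_bigr => i _; rewrite mnmE.
rewrite -[Rfun a n N]/(Rgf a N n) RgfE coef_fps_prod raddf_sum.
rewrite (eq_bigr _ (fun g _ => termE g)) -big_mkcondr /=.
have degE (g : {ffun 'I_N -> 'I_n.+1}) : (\sum_i g i)%N = mdeg (mg g).
  by rewrite mdegE; apply: eq_bigr => i _; rewrite mnmE.
case: eqP => [degm|degm]; last first.
  by rewrite big_pred0 // => g; rewrite degE; apply/andP => -[/eqP + /eqP mE]; rewrite mE.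
have lem i : (m i < n.+1)%N by rewrite ltnS -degm mdegE (bigD1 i) //= leq_addr.
rewrite (big_pred1 [ffun i => Ordinal (lem i)]) // => g.
apply/andP/eqP => [[_ /eqP mE]|->].
  by apply/ffunP=> i; apply: val_inj; rewrite ffunE /= -mE mnmE.
have mE : mg [ffun i => Ordinal (lem i)] = m by apply/mnmP=> i; rewrite mnmE ffunE.
by rewrite degE mE degm.
Qed.

Lemma Rfun0 a N : a 0%N = 1 -> Rfun a 0 N = 1.
Proof.
move=> a0; apply/mpolyP=> m; rewrite mcoeff_Rfun mcoeff1 mdeg_eq0.
by case: eqP => // ->; rewrite big1 // => i _; rewrite mnmE.
Qed.

Definition psym k N : {mpoly K[N]} := \sum_(i < N) 'X_i ^+ k.

Lemma fps_logder_Rgf a b N :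
  fps_logder a b -> fps_logder (Rgf a N) (fun k => b k *: psym k N).
Proof.
move=> ab; have -> : (fun k => b k *: psym k N) =
    \sum_(i < N) fps_dil 'X_i (fps_map (@mpolyC N K) b) :> fps _.
  apply: funext => k; rewrite coef_fps_sum scaler_sumr; apply: eq_bigr => i _.
  by rewrite /fps_dil mulrC mul_mpolyC.
by apply: fps_logder_prod => i; apply/fps_logder_dil/fps_logder_map.
Qed.

Lemma eval_ones_Rfun a k n : eval_ones k (Rfun a n) = fps_pow a k n.
Proof.
rewrite fps_powE -[LHS]/(fps_map (meval (fun=> 1)) (Rgf a k) n) RgfE rmorph_prod /=.
rewrite (eq_bigr (fun=> a)) ?prodr_const ?card_ord // => i _.
by apply: funext => m; rewrite fps_map_dil /= mevalXU /fps_dil expr1n mul1r /fps_map mevalC.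
Qed.

Lemma hsymE k N : hsym K k N = Rfun (fps_geom K) k N.
Proof.
apply/mpolyP=> m; rewrite mcoeff_Rfun big1_eq /hsym raddf_sum /=.
case: eqP => [degm|/eqP degm]; last first.
  rewrite big1 // => m' /eqP degm'; rewrite mcoeffX; case: eqP => // mE.
  by rewrite -mE degm' eqxx in degm.
have ltm : (mdeg m < k.+1)%N by rewrite degm.
rewrite (bigD1 (BMultinom ltm)) /= ?degm // mcoeffX eqxx big1 ?addr0 // => m'.
by case/andP=> _ neq; rewrite mcoeffX; case: eqP => // mE; case/eqP: neq; apply: val_inj.
Qed.

Lemma mesymE_Rfun k N : mesym N K k = Rfun (fps_1D K) k N.
Proof.
apply/mpolyP=> m; rewrite mcoeff_mesym mcoeff_Rfun /mechar; case: eqP => //= _.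
case: (boolP [forall i, (m i <= 1)%N]) => [/forallP lem|].
  by rewrite big1 // => i _; rewrite /fps_1D lem.
by rewrite negb_forall => /existsP[i lei]; rewrite (bigD1 i) //= /fps_1D (negPf lei) mul0r.
Qed.

Definition hgf N : fps {mpoly K[N]} := fun k => hsym K k N.
Definition egf N : fps {mpoly K[N]} := fun k => mesym N K k.

Lemma hgfE N : hgf N = Rgf (fps_geom K) N.
Proof. by apply: funext => k; apply: hsymE. Qed.

Lemma egfE N : egf N = Rgf (fps_1D K) N.
Proof. by apply: funext => k; apply: mesymE_Rfun. Qed.

Lemma hsym0 N : hsym K 0 N = 1.
Proof. by rewrite hsymE Rfun0. Qed.

Lemma hgfM_egf N : hgf N * fps_dil (-1) (egf N) = 1.
Proof. by rewrite hgfE egfE -(rmorphN1 (@mpolyC N K)) -Rgf_dil -RgfM fps_geomM_1B Rgf1. Qed.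

Lemma fps_logder_hgf N : fps_logder (hgf N) (fun k => fps_tgeom K k *: psym k N).
Proof. by rewrite hgfE; apply/fps_logder_Rgf/fps_logder_geom. Qed.

End RGeneratingFunction.

Section HomogeneousSymmetricFunctions.
Variable K : fieldType.
Implicit Types (a : fps K) (f g : varfam K).

Definition mnm_ext N (m : 'X_{1..N}) : 'X_{1..N.+1} :=
  [multinom oapp m 0%N (unlift ord_max i) | i < N.+1].

Lemma mnm_ext_max N (m : 'X_{1..N}) : mnm_ext m ord_max = 0%N.
Proof. by rewrite mnmE unlift_none. Qed.

Lemma mnm_ext_lift N (m : 'X_{1..N}) j : mnm_ext m (lift ord_max j) = m j.
Proof. by rewrite mnmE liftK. Qed.

Lemma mnm_extP N (m : 'X_{1..N}) (m' : 'X_{1..N.+1}) :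
  m' ord_max = 0%N -> (forall j, m' (lift ord_max j) = m j) -> m' = mnm_ext m.
Proof.
move=> m'0 m'E; apply/mnmP=> i.
by case: (unliftP ord_max i) => [j ->|->]; rewrite ?mnm_ext_max ?mnm_ext_lift.
Qed.

Lemma mcoeff_drop_last_var N (p : {mpoly K[N.+1]}) m :
  (drop_last_var p)@_m = p@_(mnm_ext m).
Proof.
rewrite {2}[p]mpolyE /drop_last_var comp_mpolyEX !raddf_sum; apply: eq_bigr => m' _.
rewrite /= !mcoeffZ mcoeffX comp_mpolyX; congr (_ * _).
rewrite (bigD1_ord ord_max) //= tnth_mktuple unlift_none /=.
under eq_bigr do rewrite tnth_mktuple liftK /=.
rewrite (_ : \prod_(i < N) _ = 'X_[[multinom m' (lift ord_max i) | i < N]]); last first.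
  by rewrite [RHS]mpolyXE_id; apply: eq_bigr => i _; rewrite mnmE.
case: (posnP (m' ord_max)) => [m'0|m'gt0]; last first.
  rewrite expr0n (negPf (lt0n_neq0 m'gt0)) mul0r mcoeff0; case: eqP => // m'E.
  by move: m'gt0; rewrite m'E mnm_ext_max.
rewrite m'0 expr0 mul1r mcoeffX; congr (_ : bool)%:R; apply/eqP/eqP => [<-|->].
  by apply: mnm_extP => // j; rewrite mnmE.
by apply/mnmP=> i; rewrite mnmE mnm_ext_lift.
Qed.

Lemma homog_symfun_Rfun a n : a 0%N = 1 -> homog_symfun n (Rfun a n).
Proof.
move=> a0; split=> N.
- apply/issymP=> s; apply/mpolyP=> m; rewrite mcoeff_sym !mcoeff_Rfun mdeg_mperm.
  case: eqP => // _; rewrite [RHS](reindex_inj (@perm_inj _ s)).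
  by apply: eq_bigr => i _; rewrite mnmE.
- apply/dhomogP=> m; rewrite mcoeff_msupp mcoeff_Rfun.
  by case: (mdeg m =P n) => [degm _ //|_]; rewrite eqxx.
apply/mpolyP=> m; rewrite mcoeff_drop_last_var !mcoeff_Rfun !mdegE !(bigD1_ord ord_max) //=.
rewrite mnm_ext_max a0 mul1r add0n.
by congr (if (_ == n) then _ else _); apply: eq_bigr => j _; rewrite mnm_ext_lift.
Qed.

Lemma homog_symfunB n f g : homog_symfun n f -> homog_symfun n g ->
  @homog_symfun K n (fun N => f N - g N).
Proof.
move=> [symf homf dropf] [symg homg dropg]; split=> N.
- exact: rpredB (symf N) (symg N).
- exact: rpredB (homf N) (homg N).
by rewrite -(dropf N) -(dropg N) /drop_last_var raddfB.
Qed.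

Lemma homog_symfunZ n c f : homog_symfun n f -> @homog_symfun K n (fun N => c *: f N).
Proof.
move=> [symf homf dropf]; split=> N.
- exact: rpredZ (symf N).
- exact: rpredZ (homf N).
by rewrite -(dropf N) /drop_last_var linearZ.
Qed.

Lemma homog_symfun_sum n (I : eqType) (r : seq I) (F : I -> varfam K) :
  {in r, forall i, homog_symfun n (F i)} -> homog_symfun n (fun N => \sum_(i <- r) F i N).
Proof.
move=> homF; split=> N; rewrite big_seq.
- by apply: rpred_sum => i /homF[symF _ _]; exact: symF.
- by apply: rpred_sum => i /homF[_ degF _]; exact: degF.
rewrite [RHS]big_seq /drop_last_var raddf_sum; apply: eq_bigr => i /homF[_ _ dropF].
exact: dropF.
Qed.

Lemma homog_symfun1 : @homog_symfun K 0 (fun=> 1).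
Proof.
split=> N; [exact: rpred1|exact: dhomog1|].
by rewrite /drop_last_var rmorph1.
Qed.

Lemma homog_symfunM m n f g : homog_symfun m f -> homog_symfun n g ->
  @homog_symfun K (m + n) (fun N => f N * g N).
Proof.
move=> [symf homf dropf] [symg homg dropg]; split=> N.
- exact: rpredM (symf N) (symg N).
- exact: dhomogM (homf N) (homg N).
by rewrite -(dropf N) -(dropg N) /drop_last_var rmorphM.
Qed.

Lemma homog_symfun_hsym n : homog_symfun n (hsym K n).
Proof.
have [symR homR dropR] := homog_symfun_Rfun n (erefl : fps_geom K 0%N = 1).
by split=> N; rewrite !hsymE.
Qed.

Lemma homog_symfun_hfun n l : is_partn n l -> homog_symfun n (hfun K l).
Proof.
case/and3P=> _ _ /eqP <-; elim: l => [|k l IHl]; first have [sym1 hom1 drop1] := homog_symfun1.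
  by split=> N; rewrite /hfun !big_nil.
have [symM homM dropM] := homog_symfunM (homog_symfun_hsym k) IHl.
by split=> N; rewrite /hfun !big_cons; [exact: symM|exact: homM|exact: dropM].
Qed.

(* A monomial of degree n in N > n variables misses a variable, which symmetry
   allows to be the last one. *)
Lemma homog_symfun_eq0S n f N :
  homog_symfun n f -> (n <= N)%N -> f N = 0 -> f N.+1 = 0.
Proof.
move=> [symf homf dropf] lenN fN0; apply/mpolyP=> m; rewrite mcoeff0.
have [degm|degm] := eqVneq (mdeg m) n; last exact: dhomog_nemf_coeff degm.
have [i /eqP mi0] : exists i, m i == 0%N.
  apply/existsP; apply: contraT; rewrite negb_exists => /forallP mgt0.
  suff: (N.+1 <= mdeg m)%N by rewrite degm; lia.
  rewrite mdegE -[X in (X <= _)%N]card_ord -sum1_card leq_sum // => j _.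
  by rewrite lt0n.
rewrite -(msym_coeff m (tperm i ord_max) (symf _)); set m' := [multinom _ | _ < _].
have -> : m' = mnm_ext [multinom m' (lift ord_max j) | j < N].
  by apply: mnm_extP => [|j]; rewrite mnmE // tpermR.
by rewrite -mcoeff_drop_last_var dropf fN0 mcoeff0.
Qed.

Lemma homog_symfun_eq0 n f : homog_symfun n f -> f n = 0 -> forall N, f N = 0.
Proof.
move=> homf fn0 N; case: (leqP n N) => [/subnKC<-|/ltnW/subKn<-].
  elim: (N - n)%N => [|d IHd]; first by rewrite addn0.
  by rewrite addnS (homog_symfun_eq0S homf) // leq_addr.
have [_ _ dropf] := homf; elim: (n - N)%N => [|d IHd]; first by rewrite subn0.
rewrite subnS; case: (n - d)%N IHd => [//|M fM0] /=.
by rewrite -dropf fM0 /drop_last_var raddf0.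
Qed.

Lemma homog_symfun_eq n f g :
  homog_symfun n f -> homog_symfun n g -> f n = g n -> forall N, f N = g N.
Proof.
move=> homf homg fgn N; apply/eqP; rewrite -subr_eq0; apply/eqP.
by apply: (homog_symfun_eq0 (homog_symfunB homf homg)); rewrite fgn subrr.
Qed.

Lemma is_expansion_at (b : seq nat -> varfam K) n f c :
    (forall l, is_partn n l -> homog_symfun n (b l)) -> homog_symfun n f ->
  f n = \sum_(l <- partns n) c l *: b l n -> is_expansion b n f c.
Proof.
move=> homb homf; apply: homog_symfun_eq homf _.
apply: (homog_symfun_sum (F := fun l N => c l *: b l N)) => l; rewrite mem_partns => /homb.
exact: homog_symfunZ.
Qed.

Lemma bcoef_expansion (b : seq nat -> varfam K) n f :
  (exists c, is_expansion b n f c) -> is_expansion b n f (bcoef b n f).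
Proof. exact: epsilon_spec. Qed.

End HomogeneousSymmetricFunctions.

(** * Expansions in complete homogeneous symmetric functions *)

Section HSpan.
Variables (K : fieldType) (N : nat).
Implicit Types p q : {mpoly K[N]}.

Definition hspan n p := exists c, p = \sum_(l <- partns n) c l *: hfun K l N.

Lemma hspan0 n : hspan n 0.
Proof. by exists (fun=> 0); rewrite big1 // => l _; rewrite scale0r. Qed.

Lemma hspanD n p q : hspan n p -> hspan n q -> hspan n (p + q).
Proof.
move=> [c ->] [d ->]; exists (fun l => c l + d l).
by rewrite -big_split; apply: eq_bigr => l _; rewrite scalerDl.
Qed.

Lemma hspanZ n x p : hspan n p -> hspan n (x *: p).
Proof.
move=> [c ->]; exists (fun l => x * c l).
by rewrite scaler_sumr; apply: eq_bigr => l _; rewrite scalerA.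
Qed.

Lemma hspan_sum n (I : eqType) (r : seq I) (F : I -> {mpoly K[N]}) :
  {in r, forall i, hspan n (F i)} -> hspan n (\sum_(i <- r) F i).
Proof.
move=> hF; rewrite big_seq; elim/big_rec: _ => [|i p /hF hFi hp]; first exact: hspan0.
exact: hspanD.
Qed.

Lemma hspan_hfun n l : is_partn n l -> hspan n (hfun K l N).
Proof.
rewrite -mem_partns => ln; exists (fun l' => (l' == l)%:R).
rewrite (bigD1_seq l) ?partns_uniq //= eqxx scale1r big1 ?addr0 // => l' /negPf->.
by rewrite scale0r.
Qed.

Lemma hspanM m n p q : hspan m p -> hspan n q -> hspan (m + n) (p * q).
Proof.
move=> [c ->] [d ->]; rewrite mulr_suml; apply: hspan_sum => l; rewrite mem_partns => lm.
rewrite mulr_sumr; apply: hspan_sum => l'; rewrite mem_partns => ln'.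
rewrite -scalerAl -scalerAr; do 2!apply: hspanZ.
have -> : hfun K l N * hfun K l' N = hfun K (sort geq (l ++ l')) N.
  by rewrite /hfun (perm_big _ (permEl (perm_sort _ _))) big_cat.
exact/hspan_hfun/is_partn_sort_cat.
Qed.

Lemma hspan1 : hspan 0 1.
Proof. by have := @hspan_hfun 0 [::] isT; rewrite /hfun big_nil. Qed.

Lemma hspan_hsym n : hspan n (hsym K n N).
Proof.
case: n => [|n]; first by rewrite hsym0; apply: hspan1.
have := @hspan_hfun n.+1 [:: n.+1]; rewrite /hfun big_seq1; apply.
by rewrite /is_partn /= addn0 eqxx.
Qed.

Lemma hspan_mesym n : hspan n (mesym N K n).
Proof.
elim/ltn_ind: n => -[|n] IHn; first by rewrite mesym0E; apply: hspan1.
suff: hspan n.+1 ((-1) ^+ n.+1 *: mesym N K n.+1).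
  by move/(hspanZ ((-1) ^+ n.+1)); rewrite scalerA -exprMn mulrNN mulr1 expr1n scale1r.
have /(congr1 (@^~ n.+1)) := hgfM_egf K N; rewrite coef_fpsM big_ord_recl /hgf hsym0 mul1r.
have sgnE m p : (-1) ^+ m * p = (-1) ^+ m *: p.
  by rewrite -mul_mpolyC rmorphXn rmorphN rmorph1.
rewrite subn0 [fps_dil _ _ _]sgnE => /eqP; rewrite addr_eq0 => /eqP ->; rewrite -scaleN1r.
apply/hspanZ/hspan_sum => i _; have lti := ltn_ord i.
have {1}-> : n.+1 = (i.+1 + (n.+1 - i.+1))%N by lia.
apply: hspanM; first exact: hspan_hsym.
by rewrite [fps_dil _ _ _]sgnE; apply/hspanZ/IHn; rewrite subSS /=; lia.
Qed.

Lemma hspan_symmetric n p : p \is symmetric -> p \is n.-homog -> hspan n p.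
Proof.
move=> symp homp; have [t [<- homt]] := sym_fundamental_homog symp homp.
rewrite comp_mpolyEX; apply: hspan_sum => m mt; apply: hspanZ.
rewrite -(dhomog_mf homt mt) comp_mpolyX -[_ m]/(\sum_(i < N) m i * i.+1)%N.
apply: (big_ind2 hspan) => [|? ? ? ?|i _]; [exact: hspan1|exact: hspanM|].
rewrite tnth_mktuple; elim: (m i) => [|d IHd]; first by rewrite mul0n expr0; exact: hspan1.
by rewrite exprS mulSn; apply: hspanM => //; apply: hspan_mesym.
Qed.

End HSpan.

Lemma hfun_expansion (K : fieldType) n (f : varfam K) :
  homog_symfun n f -> is_expansion (@hfun K) n f (bcoef (@hfun K) n f).
Proof.
move=> homf; have [symf degf _] := homf; apply: bcoef_expansion.
have [c fn] := hspan_symmetric (symf n) (degf n).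
by exists c; apply: is_expansion_at => // l; apply: homog_symfun_hfun.
Qed.

(** * Specializations of the complete homogeneous symmetric functions *)

Section ElementaryGenerators.
Variables (K : fieldType) (N : nat).

Definition elem_subst : {mpoly K[N]} -> {mpoly K[N]} :=
  comp_mpoly [tuple mesym N K i.+1 | i < N].

HB.instance Definition _ := GRing.RMorphism.on elem_subst.

Lemma elem_subst_inj : injective elem_subst.
Proof. exact: msym_fundamental_un. Qed.

Lemma elem_substZ c : {morph elem_subst : p / c *: p}.
Proof. by move=> p; apply: linearZ. Qed.

Definition e_var : fps {mpoly K[N]} :=
  fun k => if k is k'.+1 then oapp (fun i : 'I_N => 'X_i) 0 (insub k') else 1.

Lemma elem_subst_e_var : fps_map elem_subst e_var = egf K N.
Proof.
apply: funext => -[|k]; rewrite /fps_map /egf /=; first by rewrite rmorph1 mesym0E.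
case: insubP => [i _ <-|]; first by rewrite /elem_subst comp_mpolyXU -tnth_nth tnth_mktuple.
by rewrite -leqNgt => leNk; rewrite rmorph0 mesym_geqnE.
Qed.

(* The expression of h_k as a polynomial in the e_i, read off H(t) E(-t) = 1. *)
Definition h_var : fps {mpoly K[N]} := fps_inv (fps_dil (-1) e_var).

Lemma elem_subst_h_var : fps_map elem_subst h_var = hgf K N.
Proof.
have e0 : fps_dil (-1) (egf K N) 0%N = 1 by rewrite coef0_fps_dil /egf mesym0E.
have mapE : fps_map elem_subst (fps_dil (-1) e_var) = fps_dil (-1) (egf K N).
  by rewrite fps_map_dil /= rmorphN1 elem_subst_e_var.
rewrite /h_var rmorph_fps_inv /= ?mapE //; last by rewrite coef0_fps_dil.
by apply/esym/fps_inv_unique; rewrite // mulrC hgfM_egf.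
Qed.

Lemma h_var0 : h_var 0%N = 1.
Proof. exact: coef0_fps_inv. Qed.

Definition p_var : fps {mpoly K[N]} := fps_theta h_var * fps_inv h_var.

Lemma fps_logder_h_var : fps_logder h_var p_var.
Proof. by rewrite /fps_logder /p_var mulrAC -mulrA fps_mulV ?mulr1 ?h_var0. Qed.

Lemma elem_subst_p_var k : (0 < k)%N -> elem_subst (p_var k) = psym K k N.
Proof.
move=> k_gt0; have hgf0 : hgf K N 0%N = 1 by apply: hsym0.
have := fps_logder_map elem_subst fps_logder_h_var; rewrite elem_subst_h_var.
move/(fps_logderE hgf0); rewrite -(fps_logderE hgf0 (fps_logder_hgf K N)).
by move/(congr1 (@^~ k)); rewrite /fps_map => ->; case: k k_gt0 => // k _; rewrite scale1r.
Qed.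

Definition R_var (a : fps K) : fps {mpoly K[N]} := fun n => symf (Rfun a n N).

Lemma elem_subst_R_var a n : a 0%N = 1 -> elem_subst (R_var a n) = Rfun a n N.
Proof. by case/(homog_symfun_Rfun n)=> symR _ _; apply/esym/symfP/symR. Qed.

Lemma fps_logder_R_var (a b : fps K) : a 0%N = 1 -> fps_logder a b ->
  fps_logder (R_var a) (fun k => b k *: p_var k).
Proof.
move=> a0 ab; have inj_map : injective (fps_map elem_subst).
  by move=> f g eq_fg; apply: funext => n; apply/elem_subst_inj/(congr1 (@^~ n) eq_fg).
have b0 : b 0%N = 0.
  by rewrite (fps_logderE a0 ab) coef0_fpsM /fps_theta !mul0r.
have mapR : fps_map elem_subst (R_var a) = Rgf a N.
  by apply: funext => n; apply: elem_subst_R_var.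
apply: inj_map; rewrite rmorphM /= mapR.
have -> : fps_map elem_subst (fun k => b k *: p_var k) = fun k => b k *: psym K k N.
  apply: funext => -[|k]; rewrite /fps_map elem_substZ; first by rewrite b0 !scale0r.
  by rewrite elem_subst_p_var.
rewrite -(fps_logder_Rgf N ab) -mapR; apply: funext => n.
by rewrite /fps_map /fps_theta rmorphM rmorph_nat.
Qed.

Lemma hfun_elem_subst l : hfun K l N = elem_subst (\prod_(k <- l) h_var k).
Proof.
rewrite rmorph_prod; apply: eq_bigr => k _.
by rewrite -[LHS]/(hgf K N k) -elem_subst_h_var.
Qed.

End ElementaryGenerators.

Section Specialization.
Variables (K : fieldType) (A : comNzRingType) (iota : {rmorphism K -> A}).
Hypothesis charK0 : [pchar K] =i pred0.
Variables (N : nat) (eta : fps A).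
Hypothesis eta0 : eta 0%N = 1.

Definition spec_h : {mpoly K[N]} -> A :=
  mmap iota (fun i => fps_inv (fps_dil (-1) eta) i.+1).

HB.instance Definition _ := GRing.RMorphism.on spec_h.

Lemma spec_hZ c p : spec_h (c *: p) = iota c * spec_h p.
Proof. exact: mmapZ. Qed.

Lemma fps_map_spec_h_var : fps_eqmod N.+1 (fps_map spec_h (h_var K N)) eta.
Proof.
have -> : fps_map spec_h (h_var K N) = fps_inv (fps_dil (-1) (fps_map spec_h (e_var K N))).
  have mapE : fps_map spec_h (fps_dil (-1) (e_var K N)) =
      fps_dil (-1) (fps_map spec_h (e_var K N)) by rewrite fps_map_dil /= rmorphN1.
  by rewrite rmorph_fps_inv /= ?mapE ?coef0_fps_dil // /fps_map rmorph1.
rewrite -[X in fps_eqmod _ _ X](fps_inv_dilN1K eta0).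
apply: fps_eqmod_inv => [||[|k] ltkN].
- by rewrite coef0_fps_dil /fps_map rmorph1.
- by rewrite coef0_fps_dil coef0_fps_inv.
- by rewrite !coef0_fps_dil /fps_map rmorph1 coef0_fps_inv.
rewrite /fps_dil /fps_map /= (insubT (fun i => i < N)%N ltkN) /=.
by rewrite /spec_h mmapX mmap1U.
Qed.

Lemma fps_map_spec_R_var (a b : fps K) (pi r : fps A) :
    a 0%N = 1 -> fps_logder a b -> fps_logder eta pi ->
    r 0%N = 1 -> fps_logder r (fps_hadamard (fps_map iota b) pi) ->
  fps_eqmod N.+1 (fps_map spec_h (R_var N a)) r.
Proof.
move=> a0 ab etapi r0 rpi.
have h0 : fps_map spec_h (h_var K N) 0%N = 1 by rewrite /fps_map h_var0 rmorph1.
have p_pi : fps_eqmod N.+1 (fps_map spec_h (p_var K N)) pi.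
  have logh := fps_logder_map spec_h (fps_logder_h_var K N).
  exact: fps_eqmod_logder h0 eta0 logh etapi fps_map_spec_h_var.
have R0 : fps_map spec_h (R_var N a) 0%N = 1.
  rewrite /fps_map (_ : R_var N a 0%N = 1) ?rmorph1 //; apply: elem_subst_inj.
  by rewrite elem_subst_R_var // rmorph1 Rfun0.
have Rp := fps_logder_map spec_h (fps_logder_R_var N a0 ab).
apply: (fps_eqmod_of_logder (natS_lreg iota charK0) R0 r0 Rp rpi) => k ltkN.
by rewrite /fps_hadamard -p_pi //; apply: spec_hZ.
Qed.

End Specialization.

(* Sending h_k to eta_k sends p_k to pi_k, hence R_n to r_n: this turns an
   h-expansion of R_n into a linear relation between its coefficients. *)
Lemma Rfun_specialization (K : fieldType) (A : comNzRingType) (iota : {rmorphism K -> A})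
    (a b : fps K) (eta pi r : fps A) n c :
    [pchar K] =i pred0 -> a 0%N = 1 -> fps_logder a b ->
    eta 0%N = 1 -> fps_logder eta pi ->
    r 0%N = 1 -> fps_logder r (fps_hadamard (fps_map iota b) pi) ->
    is_expansion (@hfun K) n (Rfun a n) c ->
  r n = \sum_(l <- partns n) iota (c l) * \prod_(k <- l) eta k.
Proof.
move=> charK0 a0 ab eta0 etapi r0 rpi expc.
rewrite -(@fps_map_spec_R_var _ _ iota charK0 n eta eta0 a b pi r) // /fps_map.
have -> : R_var n a n = \sum_(l <- partns n) c l *: \prod_(k <- l) h_var K n k.
  apply: elem_subst_inj; rewrite elem_subst_R_var // expc rmorph_sum.
  apply: eq_bigr => l _.
  by rewrite hfun_elem_subst /= elem_substZ.
rewrite rmorph_sum big_seq [RHS]big_seq; apply: eq_bigr => l.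
rewrite mem_partns => /and3P[_ _ /eqP suml]; rewrite /= spec_hZ; congr (_ * _).
rewrite rmorph_prod big_seq [RHS]big_seq; apply: eq_bigr => k kl.
apply: (fps_map_spec_h_var iota eta0 (n := k)); rewrite ltnS -suml sumnE.
by rewrite (big_rem k kl) leq_addr.
Qed.

Lemma prod_coef_1D_mono (A : comNzRingType) n k l : (0 < k)%N -> is_partn (k * n) l ->
  \prod_(j <- l) fps_comp (fps_1D A) (fps_mono A k) j = (l == nseq n k)%:R.
Proof.
move=> k_gt0 l_part; rewrite -(all_pred1_partn k_gt0 l_part).
case: allP => [l_k|/allP/allPn[j jl /= jk]].
  by rewrite big1_seq // => j /andP[_ /l_k/eqP->]; rewrite coef_fps_comp_1D_mono // eqxx orbT.
have j0 : j != 0%N by apply: contraTneq jl => ->; case/and3P: l_part.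
by rewrite (big_rem j jl) coef_fps_comp_1D_mono //= (negPf j0) (negPf jk) mul0r.
Qed.

Section RectangularCoefficients.
Variables (K : fieldType) (a b : fps K).
Hypothesis charK0 : [pchar K] =i pred0.
Hypotheses (a0 : a 0%N = 1) (ab : fps_logder a b).

Lemma bcoef_hfun_rect k n : (0 < k)%N ->
  bcoef (@hfun K) (k * n) (Rfun a (k * n)) (nseq n k) =
  fps_exp (- fps_dil (-1) (fps_logser (fun i => b (k * i)%N))) n.
Proof.
move=> k_gt0; set g := - _.
have g0 : g 0%N = 0 by rewrite /g coef_fpsN /fps_dil mulr0 oppr0.
have etapi := fps_logder_comp_mono k_gt0 (@fps_logder_1D K).
have r_logder := fps_logder_comp_mono k_gt0 (fps_logder_exp charK0 g0).
have r0 : fps_comp (fps_exp g) (fps_mono K k) 0%N = 1 by rewrite coef0_fps_comp coef0_fps_exp.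
have expR := hfun_expansion (homog_symfun_Rfun (k * n) a0).
rewrite -(coef_fps_comp_mono_mul _ n k_gt0).
rewrite (Rfun_specialization (iota := idfun) charK0 a0 ab _ etapi r0 _ expR) /=.
- by rewrite (sum_partns_delta _ (is_partn_nseq n k_gt0)) // => l; apply: prod_coef_1D_mono.
- by rewrite coef0_fps_comp.
rewrite -[X in fps_logder _ X]/(fps_hadamard b _) linearZ /= fps_hadamard_comp_mono.
suff <- : fps_theta g =
    fps_hadamard (fun i => b (k * i)%N) (fps_dil (-1) (- fps_tgeom K)).
  exact: r_logder.
apply: funext => -[|i]; rewrite /fps_theta /fps_hadamard /fps_dil ?mul0r /= coef_fpsN.
  by rewrite oppr0 !mulr0.
by rewrite /g coef_fpsN /fps_dil /fps_tgeom /=; field; rewrite nat1r natS_neq0.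
Qed.

Lemma bcoef_hfun_row n : (0 < n)%N -> bcoef (@hfun K) n (Rfun a n) [:: n] = b n.
Proof.
move=> n_gt0; have := bcoef_hfun_rect 1 n_gt0; rewrite muln1 /= => ->.
by rewrite coef1_fps_exp coef_fpsN /fps_dil expr1 mulN1r opprK /= divr1 muln1.
Qed.

End RectangularCoefficients.

Lemma prod_indicator_two_parts (A : comNzRingType) i j l :
    (0 < i)%N -> (0 < j)%N -> is_partn (i + j) l ->
  (\prod_(k <- l) ((k == i) || (k == j))%:R : A) *+ (size l == 2) =
  (l == [:: maxn i j; minn i j])%:R.
Proof.
move=> i_gt0 j_gt0; rewrite /is_partn.
case: l => [|x [|y [|z l]]]; rewrite ?eqseq_cons ?andbF //= !inE /geq /= andbT addn0 => xy_part.
by rewrite eqxx andbT !big_cons big_nil mulr1 mulr1n -natrM mulnb; congr (_%:R); lia.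
Qed.

Section TwoPartCoefficients.
Variables (K : fieldType) (a b : fps K).
Hypothesis charK0 : [pchar K] =i pred0.
Hypotheses (a0 : a 0%N = 1) (ab : fps_logder a b).
Implicit Types (f : fps {poly K}) (q u v : fps K).

Lemma Xcoef2_of_logder_1DX q pi (r : fps {poly K}) :
    q 0%N = 0 -> fps_logder (fps_1DX q) pi ->
    r 0%N = 1 -> fps_logder r (fps_hadamard (fps_map polyC b) pi) ->
  fps_Xcoef 2 r *+ 2 = fps_hadamard b q ^+ 2 - fps_hadamard b (q ^+ 2).
Proof.
move=> q0 /Xcoef_logder_1DX[pi0 pi1 pi2] r0 logr.
have theta_inj := fps_theta_inj (natS_lreg idfun charK0).
have coef_at0 s : fps_Xcoef s r 0%N = (s == 0%N)%:R by rewrite /fps_Xcoef r0 coef1.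
have bpi0 : fps_hadamard b (fps_Xcoef 0 pi) = 0.
  by rewrite pi0; apply: funext => n; apply: mulr0.
have logr_coef s : fps_theta (fps_Xcoef s r) =
    \sum_(t < s.+1) fps_hadamard b (fps_Xcoef t pi) * fps_Xcoef (s - t) r.
  rewrite -fps_theta_Xcoef logr fps_XcoefM; apply: eq_bigr => t _.
  by rewrite fps_Xcoef_hadamard.
have r_0 : fps_Xcoef 0 r = 1.
  by apply: theta_inj; rewrite ?coef_at0 // logr_coef big_ord1 bpi0 mul0r fps_theta1.
have r_1 : fps_Xcoef 1 r = fps_hadamard b q.
  apply: theta_inj; first by rewrite coef_at0 /fps_hadamard q0 mulr0.
  rewrite logr_coef !big_ord_recl big_ord0 /= bpi0 pi1 r_0 mul0r add0r addr0 mulr1.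
  by rewrite fps_theta_hadamard.
apply: theta_inj.
  rewrite coef_fpsB !expr2 coef0_fpsM coef_fpsMn coef_at0 /fps_hadamard coef0_fpsM q0.
  by rewrite mul0rn !mulr0 subr0.
rewrite raddfB raddfMn /= fps_theta_hadamard !expr2 !fps_thetaM.
rewrite logr_coef !big_ord_recl big_ord0 /= bpi0 pi1 pi2 r_1 r_0 fps_theta_hadamard.
have -> : fps_theta q * q + q * fps_theta q = (q * fps_theta q) *+ 2 by ring.
by rewrite raddfN raddfMn /=; ring.
Qed.

Lemma sum_bcoef_hfun_two_parts q n : q 0%N = 0 ->
  (\sum_(l <- partns n) bcoef (@hfun K) n (Rfun a n) l *
     ((\prod_(k <- l) q k) *+ (size l == 2))) *+ 2 =
  (fps_hadamard b q ^+ 2 - fps_hadamard b (q ^+ 2)) n.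
Proof.
move=> q0; have eta0 : fps_1DX q 0%N = 1 by rewrite /fps_1DX q0 scale0r addr0.
pose pi := fps_theta (fps_1DX q) * fps_inv (fps_1DX q).
have etapi : fps_logder (fps_1DX q) pi by rewrite /fps_logder /pi mulrAC -mulrA fps_mulV ?mulr1.
have [|r r0 logr] := fps_logder_exists polyC charK0 (c := fps_hadamard (fps_map polyC b) pi).
  by rewrite /fps_hadamard /pi coef0_fpsM /fps_theta !mul0r mulr0.
have expR := hfun_expansion (homog_symfun_Rfun n a0).
rewrite -(Xcoef2_of_logder_1DX q0 etapi r0 logr).
rewrite coef_fpsMn /fps_Xcoef; congr (_ *+ 2).
rewrite (Rfun_specialization (iota := polyC) charK0 a0 ab eta0 etapi r0 logr expR) coef_sum.
rewrite big_seq [RHS]big_seq; apply: eq_bigr => l; rewrite mem_partns => /and3P[_ l0 _].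
rewrite coefCM; congr (_ * _).
have -> : \prod_(k <- l) fps_1DX q k = (\prod_(k <- l) q k) *: 'X^(size l).
  elim: l l0 => [|k l IHl]; first by rewrite !big_nil scale1r.
  rewrite inE negb_or eq_sym => /andP[k0 /IHl prodE]; rewrite !big_cons prodE /fps_1DX.
  by rewrite (negPf k0) add0r -scalerAl -scalerAr scalerA exprS.
by rewrite coefZ coefXn eq_sym mulr_natr.
Qed.

Lemma bcoef_hfun_two i j : (0 < i)%N -> (0 < j)%N ->
  bcoef (@hfun K) (i + j) (Rfun a (i + j)) [:: maxn i j; minn i j] =
  if i == j then (b i ^+ 2 - b (i + j)%N) / 2%:R else b i * b j - b (i + j)%N.
Proof.
move=> i_gt0 j_gt0; pose q : fps K := fun m => ((m == i) || (m == j))%:R.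
have q0 : q 0%N = 0 by rewrite /q !ltn_eqF.
have := sum_bcoef_hfun_two_parts (i + j) q0.
rewrite (sum_partns_delta _ (is_partn_two i_gt0 j_gt0)); last first.
  by move=> l; apply: prod_indicator_two_parts.
rewrite -mulr_natr => coefE; apply: (mulIf (natS_neq0 charK0 1)); rewrite {}coefE.
have [eq_ij|neq_ij] := eqVneq i j.
  rewrite divfK ?natS_neq0 //.
  have -> : q = fps_mono K i by apply: funext => m; rewrite /q -eq_ij orbb.
  rewrite fps_hadamard_mono exprZn !fps_monoX fps_hadamard_mono coef_fpsB !coef_fpsZ /fps_mono.
  by rewrite -eq_ij muln2 addnn eqxx !mulr1.
have -> : q = fps_mono K i + fps_mono K j.
  apply: funext => m; rewrite coef_fpsD /q /fps_mono.
  by case: eqP => [->|]; rewrite ?add0r // (negPf neq_ij) addr0.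
have mono2 k l : k != l -> fps_mono K (k * 2) (k + l)%N = 0.
  by rewrite /fps_mono muln2 -addnn eqn_add2l eq_sym => /negPf->.
have hadamardD : {morph fps_hadamard b : u v / u + v} := raddfD _.
rewrite hadamardD !sqrrD !mulr2n !fps_monoX fps_monoM !hadamardD !fps_hadamard_mono.
rewrite -scalerAl -scalerAr !exprZn !fps_monoX fps_monoM.
rewrite !(coef_fpsB, coef_fpsD, coef_fpsZ) mono2 // [(i + j)%N]addnC mono2 1?eq_sym //.
by rewrite /fps_mono eqxx mulr1n; ring.
Qed.

End TwoPartCoefficients.

(** * Alternants *)

Section Alternant.
Variables (A : comNzRingType) (x : nat -> A).

Definition alternant N (l : nat -> nat) : A := \det (\matrix_(i < N, j < N) x i ^+ l j).

Lemma eq_alternant N l l' :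
  (forall j, (j < N)%N -> l j = l' j) -> alternant N l = alternant N l'.
Proof. by move=> eql; congr (\det _); apply/matrixP=> i j; rewrite !mxE eql. Qed.

Lemma det_sub_next_col N (f : nat -> nat -> A) (z : nat -> A) :
  \det (\matrix_(i < N.+1, j < N.+1) f i j) =
  \det (\matrix_(i < N.+1, j < N.+1) (f i j - if (j < N)%N then z j * f i j.+1 else 0)).
Proof.
pose U : 'M[A]_N.+1 := \matrix_(k, j) ((k == j)%:R - (k == j.+1 :> nat)%:R * z j).
have detU : \det U = 1.
  rewrite det_trig; last first.
    apply/is_trig_mxP => i j ltij; rewrite mxE -val_eqE /= !ltn_eqF ?mul0r ?subr0 //.
    exact: leqW.
  by rewrite big1 // => i _; rewrite mxE eqxx (ltn_eqF (ltnSn _)) mul0r subr0.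
rewrite -[LHS]mulr1 -detU -det_mulmx; congr (\det _); apply/matrixP=> i j.
rewrite !mxE; under eq_bigr do rewrite !mxE mulrBr.
rewrite sumrB; congr (_ - _).
  rewrite (bigD1 j) //= eqxx mulr1 big1 ?addr0 // => k /negPf->.
  by rewrite mulr0.
rewrite (eq_bigr (fun k : 'I_N.+1 => if k == j.+1 :> nat then z j * f i k else 0)) => [|k _].
  by rewrite -big_mkcond (big_ord1_eq _ (fun k => z j * f i k)).
by case: eqP => _; rewrite ?mul0r ?mulr0 // mul1r mulrC.
Qed.

Lemma sum_exchange_power (y z : A) m n : (m <= n)%N ->
  (y - z) * \sum_(m <= k < n) y ^+ k * z ^+ (n - k.+1) = y ^+ n - z ^+ (n - m) * y ^+ m.
Proof.
move=> lemn; rewrite mulr_sumr.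
rewrite (eq_big_nat _ _ (F2 := fun k => y ^+ k.+1 * z ^+ (n - k.+1) - y ^+ k * z ^+ (n - k))).
  by rewrite telescope_sumr // subnn expr0 mulr1 [_ * y ^+ m]mulrC.
by move=> k /andP[_ ltkn]; rewrite -[(n - k)%N]subnSK // !exprS; ring.
Qed.

Lemma alternant_rec N l : (forall j, (j < N)%N -> (l j.+1 <= l j)%N) ->
  alternant N.+1 l = \prod_(i < N) (x i - x N) * x N ^+ l N *
    \det (\matrix_(i < N, j < N) \sum_(l j.+1 <= m < l j) x i ^+ m * x N ^+ (l j - m.+1)).
Proof.
move=> decl; pose z j := x N ^+ (l j - l j.+1).
rewrite /alternant (det_sub_next_col _ (fun i j => x i ^+ l j) z).
rewrite (expand_det_row _ ord_max) big_ord_recr /= big1 ?add0r; last first.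
  by move=> j _; rewrite !mxE /= ltn_ord -exprD subnK ?decl // subrr mul0r.
rewrite !mxE ltnn subr0 mulrAC mulrC; congr (_ * _).
rewrite /cofactor addnn -signr_odd odd_double expr0 mul1r.
have <- : \det (diag_mx (\row_(i < N) (x i - x N))) = \prod_(i < N) (x i - x N).
  by rewrite det_diag; apply: eq_bigr => i _; rewrite mxE.
rewrite -det_mulmx; congr (\det _); apply/matrixP=> i j.
rewrite mul_diag_mx !mxE !lift_max ltn_ord sum_exchange_power //.
exact: decl.
Qed.

End Alternant.

Definition staircase N (j : nat) := (N.-1 - j)%N.

Definition nonincreasing (l : nat -> nat) := forall i, (l i.+1 <= l i)%N.

Definition strict_decr N (v : nat -> nat) :=
  forall i j, (i < j)%N -> (j < N)%N -> (v j < v i)%N.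

Lemma strict_decr_staircase N : strict_decr N (staircase N).
Proof. by move=> i j; rewrite /staircase; lia. Qed.

Lemma strict_decr_addn_staircase (l : seq nat) N : sorted geq l ->
  strict_decr N (fun j => nth 0 l j + staircase N j)%N.
Proof.
move=> sortl i j ltij ltjN; have := nth_sorted_geq sortl (ltnW ltij).
by rewrite /staircase; lia.
Qed.

Lemma perm_increasing N (s : 'S_N) :
  (forall i j : 'I_N, (i < j)%N -> (s i < s j)%N) -> s = 1%g.
Proof.
have ge_id (t : 'S_N) : (forall i j : 'I_N, (i < j)%N -> (t i < t j)%N) ->
    forall i : 'I_N, (i <= t i)%N.
  move=> incr [i]; elim: i => // i IHi ltiN /=.
  apply: leq_ltn_trans (IHi (ltnW ltiN)) _.
  exact: incr.
move=> incr; apply/permP=> i; rewrite perm1; apply: ord_inj; apply/eqP.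
rewrite eqn_leq ge_id // andbT; rewrite -[X in (_ <= nat_of_ord X)%N](permK s i).
apply: ge_id => {}i j ltij; rewrite ltnNge; apply/negP; rewrite leq_eqVlt => /orP[/eqP|].
  by move/ord_inj/perm_inj => eij; rewrite eij ltnn in ltij.
by move/incr; rewrite !permKV ltnNge ltnW.
Qed.

Section Interlacing.
Variables c N : nat.
Implicit Types (lam : nat -> nat) (mu : {ffun 'I_N -> 'I_c.+1}).

Definition interlace lam mu : bool := [forall j : 'I_N, (lam j.+1 <= mu j <= lam j)%N].

Definition ext0 mu (i : nat) : nat := oapp (fun j : 'I_N => mu j : nat) 0%N (insub i).

Lemma ext0_ord mu (j : 'I_N) : ext0 mu j = mu j.
Proof. by rewrite /ext0 valK. Qed.

Lemma ext0_out mu i : (N <= i)%N -> ext0 mu i = 0%N.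
Proof. by move=> leNi; rewrite /ext0 insubF // ltnNge leNi. Qed.

Lemma interlaceP lam mu :
  reflect (forall i, (i < N)%N -> (lam i.+1 <= ext0 mu i <= lam i)%N) (interlace lam mu).
Proof.
apply: (iffP forallP) => [inter i ltiN|inter j]; last by rewrite -ext0_ord inter.
by rewrite (ext0_ord _ (Ordinal ltiN)); apply: inter (Ordinal ltiN).
Qed.

Lemma interlace_le lam mu i : interlace lam mu -> (ext0 mu i <= lam i)%N.
Proof.
move/interlaceP=> inter; case: (ltnP i N) => [/inter/andP[]//|leNi].
by rewrite ext0_out.
Qed.

Lemma interlace_nonincreasing lam mu : interlace lam mu -> nonincreasing (ext0 mu).
Proof.
move=> inter i; case: (ltnP i N) => [ltiN|leNi]; last by rewrite ext0_out // leqW.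
have /andP[le_mu _] := interlaceP _ _ inter i ltiN.
exact: leq_trans (interlace_le i.+1 inter) le_mu.
Qed.

Lemma alternant_branch (A : comNzRingType) (x : nat -> A) lam :
    nonincreasing lam -> (lam 0 <= c)%N ->
  alternant x N.+1 (fun j => lam j + staircase N.+1 j)%N =
  \prod_(i < N) (x i - x N) *
  \sum_(mu | interlace lam mu) x N ^+ (\sum_(j < N) (lam j - mu j) + lam N) *
     alternant x N (fun j => ext0 mu j + staircase N j)%N.
Proof.
move=> declam lamc; have lam_c j : (lam j <= c)%N.
  by elim: j => // j; apply: leq_trans (declam j).
rewrite -[LHS]/(alternant x N.+1 (fun j => lam j + (N - j))%N) alternant_rec; last first.
  by move=> j ltjN; have := declam j; lia.
rewrite subnn addn0 -mulrA; congr (_ * _).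
pose H (i j : 'I_N) (u : 'I_c.+1) := x i ^+ (u + (N.-1 - j)) * x N ^+ (lam j - u).
rewrite -det_tr /determinant.
have entryE (s : 'S_N) (j : 'I_N) :
    ((\matrix_(i < N, j < N) (\sum_(lam j.+1 + (N - j.+1) <= m < lam j + (N - j))
         x i ^+ m * x N ^+ (lam j + (N - j) - m.+1)))^T : 'M[A]_N) j (s j) =
    \sum_(u : 'I_c.+1 | (lam j.+1 <= u <= lam j)%N) H (s j) j u.
  rewrite !mxE; have ltjN := ltn_ord j.
  rewrite big_addn (_ : (_ - _ = (lam j).+1)%N); last by lia.
  rewrite big_geq_mkord /= (big_ord_widen_cond c.+1 (fun i => lam j.+1 <= i)%N
    (fun i => x (s j) ^+ (i + (N - j.+1)) * x N ^+ (lam j + (N - j) - (i + (N - j.+1)).+1)));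
    last by rewrite ltnS.
  apply: eq_big => [u|u _]; first by rewrite ltnS.
  by rewrite /H; congr (_ ^+ _ * _ ^+ _); lia.
under eq_bigr => s _.
  rewrite (eq_bigr _ (fun j _ => entryE s j)) bigA_distr_big_dep mulr_sumr.
  over.
rewrite exchange_big /= mulr_sumr; apply: eq_big => [mu|mu _].
  by apply/familyP/forallP => mui j; have := mui j.
rewrite addnC exprD -mulrA; congr (_ * _).
rewrite /alternant -det_tr /determinant mulr_sumr; apply: eq_bigr => s _.
rewrite mulrCA; congr (_ * _); rewrite big_split expr_sum mulrC; congr (_ * _).
by apply: eq_bigr => j _; rewrite !mxE ext0_ord.
Qed.

End Interlacing.

(** * Semistandard tableaux and the bialternant formula *)

Section Shapes.
Variables (r c : nat).
Local Notation box := ('I_r * 'I_c)%type.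
Implicit Types (D : {set box}) (lam mu : nat -> nat).

Definition yd lam : {set box} := [set p : box | (p.2 < lam p.1)%N].

Definition row_closed D :=
  forall i (j j' : 'I_c), (j <= j')%N -> (i, j') \in D -> (i, j) \in D.

Definition fits_box lam := (forall i, (lam i <= c)%N) /\ (forall i, (r <= i)%N -> lam i = 0%N).

Definition horizontal_strip D D' :=
  (D' \subset D) && [forall i : 'I_r, forall i' : 'I_r, forall j : 'I_c,
                       ((i < i')%N && ((i', j) \in D)) ==> ((i, j) \in D')].

Lemma horizontal_stripP D D' :
  reflect (D' \subset D /\
           forall (i i' : 'I_r) j, (i < i')%N -> (i', j) \in D -> (i, j) \in D')
          (horizontal_strip D D').
Proof.
apply: (iffP andP) => -[sD'D colD]; split=> //.
  move=> i i' j lti ijD.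
  by have /forallP/(_ i')/forallP/(_ j)/implyP := forallP colD i; rewrite lti; apply.
by do 3![apply/forallP => ?]; apply/implyP => /andP[]; apply: colD.
Qed.

Lemma yd_row_closed lam : row_closed (yd lam).
Proof. by move=> i j j'; rewrite !inE /=; apply: leq_ltn_trans. Qed.

Lemma card_ord_ltn m : (m <= c)%N -> #|[set k : 'I_c | (k < m)%N]| = m.
Proof.
move=> lemc; rewrite -sum1dep_card -(big_ord_widen_cond c xpredT (fun=> 1%N)) //.
by rewrite sum1_card card_ord.
Qed.

Lemma mem_downset_ord (B : {set 'I_c}) :
    (forall j j' : 'I_c, (j <= j')%N -> j' \in B -> j \in B) ->
  forall k : 'I_c, (k \in B) = (k < #|B|)%N.
Proof.
move=> downB k; apply/idP/idP => [kB|].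
  rewrite -(@card_ord_ltn k.+1) //; apply: subset_leq_card.
  by apply/subsetP=> j; rewrite inE ltnS => /downB; apply.
apply: contraLR => kB; rewrite -leqNgt -[X in (_ <= X)%N](card_ord_ltn (ltnW (ltn_ord k))).
apply: subset_leq_card; apply/subsetP=> j jB; rewrite inE ltnNge.
by apply: contra kB => /downB; apply.
Qed.

Definition row_len D (i : nat) : nat :=
  oapp (fun i' : 'I_r => #|[set k | (i', k) \in D]|) 0%N (insub i).

Lemma row_len_ord D (i : 'I_r) : row_len D i = #|[set k | (i, k) \in D]|.
Proof. by rewrite /row_len valK. Qed.

Lemma row_len_out D i : (r <= i)%N -> row_len D i = 0%N.
Proof. by move=> leri; rewrite /row_len insubF // ltnNge leri. Qed.

Lemma row_len_le D i : (row_len D i <= c)%N.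
Proof.
rewrite /row_len; case: insubP => //= i' _ _.
by rewrite -[X in (_ <= X)%N](card_ord c) max_card.
Qed.

Lemma yd_row_len D : row_closed D -> yd (row_len D) = D.
Proof.
move=> rowD; apply/setP=> -[i j]; rewrite inE row_len_ord -mem_downset_ord ?inE //.
by move=> k k' lek; rewrite !inE; apply: rowD.
Qed.

Lemma row_len_yd lam i : fits_box lam -> row_len (yd lam) i = lam i.
Proof.
case=> lamc lamr; case: (leqP r i) => [leri|ltir]; first by rewrite row_len_out ?lamr.
rewrite (row_len_ord _ (Ordinal ltir)) /= -[RHS](card_ord_ltn (lamc i)).
by apply: eq_card => k; rewrite !inE.
Qed.

Lemma card_yd lam : (forall i, (lam i <= c)%N) -> #|yd lam| = (\sum_(i < r) lam i)%N.
Proof.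
move=> lamc; rewrite -sum1_card (eq_bigl (fun p : box => (p.2 < lam p.1)%N)); last first.
  by move=> p; rewrite inE.
rewrite -(pair_big_dep xpredT (fun (i : 'I_r) (j : 'I_c) => (j < lam i)%N) (fun _ _ => 1%N)).
by apply: eq_bigr => i _; rewrite /= sum1dep_card card_ord_ltn.
Qed.

Lemma horizontal_strip_yd lam mu :
    nonincreasing lam -> fits_box lam -> fits_box mu ->
  reflect (forall i, (lam i.+1 <= mu i <= lam i)%N) (horizontal_strip (yd lam) (yd mu)).
Proof.
move=> declam [lamc lamr] [muc mur].
apply: (iffP (horizontal_stripP _ _)) => [[sub strip] i|inter].
  apply/andP; split; rewrite leqNgt; apply/negP => lt_mu.
    have ltr : (i.+1 < r)%N by rewrite ltnNge; apply: contraL lt_mu => /lamr->.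
    have ltc := leq_trans lt_mu (lamc i.+1).
    have := strip (Ordinal (ltnW ltr)) (Ordinal ltr) (Ordinal ltc) (ltnSn i).
    by rewrite !inE /= ltnn => /(_ lt_mu).
  have ltr : (i < r)%N by rewrite ltnNge; apply: contraL lt_mu => /mur->.
  have ltc := leq_trans lt_mu (muc i).
  by have := subsetP sub (Ordinal ltr, Ordinal ltc); rewrite !inE /= ltnn => /(_ lt_mu).
have lam_anti i i' : (i <= i')%N -> (lam i' <= lam i)%N.
  by apply: (homo_leq (r := fun m n => n <= m)%N) => // m n p le_nm /leq_trans; apply.
split=> [|i i' j lti].
  by apply/subsetP=> p; rewrite !inE => /leq_trans; apply; case/andP: (inter p.1).
rewrite !inE /= => /leq_trans; apply; case/andP: (inter i) => le_mu _.
exact: leq_trans (lam_anti _ _ lti) le_mu.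
Qed.

End Shapes.

Lemma sum_ord_support (F : nat -> nat) m n :
    (forall i, (m <= i)%N -> F i = 0%N) -> (forall i, (n <= i)%N -> F i = 0%N) ->
  (\sum_(i < m) F i = \sum_(i < n) F i)%N.
Proof.
have widen k k' : (k <= k')%N -> (forall i, (k <= i)%N -> F i = 0%N) ->
    (\sum_(i < k) F i = \sum_(i < k') F i)%N.
  move=> lek F0; rewrite (big_ord_widen k' F lek) big_mkcond; apply: eq_bigr => i _.
  by case: ltnP => // /F0.
by move=> Fm Fn; case: (leqP m n) => [le|/ltnW le]; [|apply/esym]; apply: widen.
Qed.

Section Tableaux.
Variables (r c : nat).
Local Notation box := ('I_r * 'I_c)%type.
Local Notation tableau N := {ffun box -> 'I_N.+1}.
Implicit Types (D : {set box}) (lam : nat -> nat).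

(* A tableau with entries < N is extended to the whole r x c box by the value N
   outside its shape. *)
Definition tab_valid N (T : tableau N) : bool :=
  [forall p : box, forall q : box,
     ((p.1 == q.1) && (p.2 <= q.2)%N ==> (T p <= T q)%N) &&
     ([&& p.2 == q.2, (p.1 < q.1)%N & (T q < N)%N] ==> (T p < T q)%N)].

Definition tab_shape N m (T : tableau N) : {set box} := [set p | (T p < m)%N].

Lemma tab_validP N (T : tableau N) :
  reflect ((forall i (j j' : 'I_c), (j <= j')%N -> (T (i, j) <= T (i, j'))%N) /\
           (forall (i i' : 'I_r) j, (i < i')%N -> (T (i', j) < N)%N ->
              (T (i, j) < T (i', j))%N)) (tab_valid T).
Proof.
apply: (iffP forallP) => [validT|[rowT colT] [i j]].
  split=> [i j j' lej|i i' j lti ltN].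
    have /forallP/(_ (i, j'))/andP[/implyP + _] := validT (i, j).
    by apply; rewrite eqxx.
  have /forallP/(_ (i', j))/andP[_ /implyP] := validT (i, j).
  by apply; rewrite eqxx lti.
apply/forallP => -[i' j']; apply/andP; split; apply/implyP => /=.
  by case/andP=> /eqP-> /rowT.
by case/and3P=> /eqP->; apply: colT.
Qed.

Lemma tab_shape_row_closed N m (T : tableau N) : tab_valid T -> row_closed (tab_shape m T).
Proof. by case/tab_validP=> rowT _ i j j' /(rowT i); rewrite !inE; apply: leq_ltn_trans. Qed.

Lemma tab_row_le N (T : tableau N) i j : tab_valid T -> (T (i, j) < N)%N -> (i <= T (i, j))%N.
Proof.
case/tab_validP=> _ colT; case: i => i; elim: i => // i IHi ltir ltN.
have lt_T := colT (Ordinal (ltnW ltir)) (Ordinal ltir) j (ltnSn i) ltN.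
exact: leq_ltn_trans (IHi (ltnW ltir) (ltn_trans lt_T ltN)) lt_T.
Qed.

Lemma tab_horizontal_strip N (T : tableau N.+1) : tab_valid T ->
  horizontal_strip (tab_shape N.+1 T) (tab_shape N T).
Proof.
case/tab_validP=> _ colT; apply/horizontal_stripP; split.
  by apply/subsetP=> p; rewrite !inE; apply: leqW.
by move=> i i' j lti; rewrite !inE => ltN; apply: leq_trans (colT i i' j lti ltN) _.
Qed.

Section LastEntry.
Variable N : nat.

Definition tab_restrict (T : tableau N.+1) : tableau N := [ffun p => inord (minn (T p) N)].

Definition tab_extend D (T : tableau N) : tableau N.+1 :=
  [ffun p => if p \in D then inord (T p) else ord_max].

Lemma tab_restrictE T p : tab_restrict T p = minn (T p) N :> nat.
Proof. by rewrite ffunE inordK // ltnS geq_minr. Qed.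

Lemma tab_extendE D T p : tab_extend D T p = (if p \in D then T p : nat else N.+1) :> nat.
Proof. by rewrite ffunE; case: ifP => // _; rewrite inordK // ltnW // ltnS ltn_ord. Qed.

Lemma tab_restrict_valid T : tab_valid T -> tab_valid (tab_restrict T).
Proof.
case/tab_validP=> rowT colT; apply/tab_validP; split=> [i j j' lej|i i' j lti].
  by rewrite !tab_restrictE; have := rowT i j j' lej; lia.
by rewrite !tab_restrictE; have := colT i i' j lti; lia.
Qed.

Lemma tab_shape_restrict T : tab_shape N (tab_restrict T) = tab_shape N T.
Proof. by apply/setP=> p; rewrite !inE tab_restrictE; lia. Qed.

Lemma tab_restrictK D T : tab_shape N.+1 T = D -> tab_extend D (tab_restrict T) = T.
Proof.
move=> <-; apply/ffunP=> p; apply: ord_inj; rewrite tab_extendE tab_restrictE inE.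
by case: (T p) => m ltm /=; case: ltnP; lia.
Qed.

Variables (D : {set box}) (T : tableau N).

Lemma tab_shape_extend : tab_shape N.+1 (tab_extend D T) = D.
Proof.
by apply/setP=> p; rewrite inE tab_extendE; case: ifP => _; rewrite ?ltnn ?ltn_ord.
Qed.

Hypothesis sTD : tab_shape N T \subset D.

Lemma tab_shape_extend_pred : tab_shape N (tab_extend D T) = tab_shape N T.
Proof.
apply/setP=> p; rewrite !inE tab_extendE; have := subsetP sTD p; rewrite inE.
by case: (p \in D); lia.
Qed.

Lemma tab_extendK : tab_restrict (tab_extend D T) = T.
Proof.
apply/ffunP=> p; apply: ord_inj; rewrite tab_restrictE tab_extendE.
have := subsetP sTD p; rewrite inE; case: (T p) => m ltm /=; case: (p \in D); lia.
Qed.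

Lemma tab_extend_valid : row_closed D -> horizontal_strip D (tab_shape N T) ->
  tab_valid T -> tab_valid (tab_extend D T).
Proof.
move=> rowD /horizontal_stripP[_ colD] /tab_validP[rowT colT].
apply/tab_validP; split=> [i j j' lej|i i' j lti]; rewrite !tab_extendE.
  case: ifP => [_|Dj]; first by case: ifP => _; [exact: rowT|rewrite ltnW // ltn_ord].
  by case: ifP => // /(rowD _ _ _ lej); rewrite Dj.
case: ifP => [Di' _|]; last by rewrite ltnn.
have := colD _ _ _ lti Di'; rewrite inE => ltN.
rewrite (subsetP sTD) ?inE //; have := colT i i' j lti; have := ltn_ord (T (i', j)).
by lia.
Qed.

End LastEntry.

Section GeneratingFunction.
Variables (A : comNzRingType) (x : nat -> A).

Definition tab_gf D N : A :=
  \sum_(T : tableau N | tab_valid T && (tab_shape N T == D)) \prod_(p in D) x (T p).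

Lemma tab_gf_strip D N : row_closed D ->
  tab_gf D N.+1 =
  \sum_(D' | horizontal_strip D D') x N ^+ #|D :\: D'| * tab_gf D' N.
Proof.
move=> rowD; rewrite {1}/tab_gf.
rewrite (partition_big (tab_shape N) (horizontal_strip D)) => [|T]; last first.
  by case/andP=> validT /eqP <-; apply: tab_horizontal_strip.
apply: eq_bigr => D' stripD'; have [sD'D _] := horizontal_stripP _ _ stripD'.
rewrite /tab_gf mulr_sumr (reindex_onto (tab_extend D) (@tab_restrict N)) => [|T]; last first.
  by case/andP=> /andP[_ /eqP/tab_restrictK].
apply: eq_big => [T|T /andP[/andP[_ /eqP shT] /eqP TK]].
  apply/idP/idP => [/andP[/andP[/andP[validT _] /eqP shT] /eqP TK]|/andP[validT /eqP shT]].
    by rewrite -TK tab_restrict_valid //= tab_shape_restrict shT.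
  have sTD : tab_shape N T \subset D by rewrite shT.
  rewrite tab_shape_extend tab_shape_extend_pred // tab_extendK // shT !eqxx !andbT.
  by rewrite tab_extend_valid // shT.
have shT' : tab_shape N T = D' by rewrite -TK tab_shape_restrict.
rewrite (big_setID D') /= (setIidPr sD'D) mulrC; congr (_ * _).
  rewrite (eq_bigr (fun=> x N)) ?prodr_const // => p /setDP[pD].
  rewrite -shT' inE tab_extendE pD; move=> leN; congr x.
  by apply/eqP; rewrite eqn_leq -ltnS ltn_ord leqNgt.
by apply: eq_bigr => p pD'; rewrite tab_extendE (subsetP sD'D).
Qed.

Lemma tab_gf_last0 D N :
  row_closed D -> horizontal_strip D D -> x N = 0 -> tab_gf D N.+1 = tab_gf D N.
Proof.
move=> rowD stripD xN0; rewrite tab_gf_strip // (bigD1 D) //=.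
rewrite setDv cards0 mul1r big1 ?addr0 // => D' /andP[/horizontal_stripP[sD'D _] neq].
rewrite xN0 expr0n (_ : _ == 0 = false)%N ?mul0r //; apply: contraNF neq.
by rewrite cards_eq0 setD_eq0 eqEsubset sD'D.
Qed.

Lemma tab_gf_eq0 D N (i : 'I_r) j : (N <= i)%N -> (i, j) \in D -> tab_gf D N = 0.
Proof.
move=> leNi ijD; rewrite /tab_gf big1 // => T /andP[validT /eqP shT].
have ltN : (T (i, j) < N)%N by move: ijD; rewrite -shT inE.
by have := leq_ltn_trans (tab_row_le validT ltN) ltN; rewrite ltnNge leNi.
Qed.

Local Notation yd := (@yd r c).

Definition first_rows N D : {ffun 'I_N -> 'I_c.+1} := [ffun j : 'I_N => inord (row_len D j)].

(* Only Young diagrams with at most N rows carry tableaux with entries < N, and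
   such a diagram is determined by the lengths of its first N rows. *)
Lemma tab_gf_neq0_yd D N : tab_gf D N != 0 -> yd (ext0 (first_rows N D)) = D.
Proof.
move=> gf_neq0; have rowD : row_closed D.
  case: (pickP (fun T : tableau N => tab_valid T && (tab_shape N T == D))) => [T|noT].
    by case/andP=> validT /eqP <-; apply: tab_shape_row_closed.
  by case/eqP: gf_neq0; rewrite /tab_gf big_pred0.
rewrite -[RHS]yd_row_len //; congr yd; apply: funext => i.
case: (ltnP i N) => [ltiN|leNi].
  by rewrite (ext0_ord _ (Ordinal ltiN)) ffunE inordK // ltnS row_len_le.
rewrite ext0_out //; case: (ltnP i r) => [ltir|leri]; last by rewrite row_len_out.
rewrite (row_len_ord _ (Ordinal ltir)); apply/esym/eqP; rewrite cards_eq0.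
apply/eqP/setP=> k; rewrite !inE; apply: contraNF gf_neq0 => ikD.
by apply/eqP; apply: tab_gf_eq0 ikD.
Qed.

Lemma first_rows_yd N (mu : {ffun 'I_N -> 'I_c.+1}) :
  fits_box r c (ext0 mu) -> first_rows N (yd (ext0 mu)) = mu.
Proof.
move=> fit; apply/ffunP=> j; apply: ord_inj; rewrite ffunE row_len_yd // ext0_ord.
by rewrite inordK.
Qed.

Lemma fits_box_first_rows N D : fits_box r c (ext0 (first_rows N D)).
Proof.
split=> i; rewrite /ext0; case: insubP => //= j _ ji; rewrite ffunE inordK ?ltnS ?row_len_le //.
by rewrite ji; apply: row_len_out.
Qed.

Lemma fits_box_interlace N lam (mu : {ffun 'I_N -> 'I_c.+1}) :
  fits_box r c lam -> interlace lam mu -> fits_box r c (ext0 mu).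
Proof.
move=> [lamc lamr] inter; split=> i; first exact: leq_trans (interlace_le i inter) (lamc i).
by move/lamr=> lam0; have := interlace_le i inter; rewrite lam0 leqn0 => /eqP.
Qed.

Lemma tab_gf_branch N lam :
    nonincreasing lam -> fits_box r c lam ->
    (forall i, (N < i)%N -> lam i = 0%N) ->
  tab_gf (yd lam) N.+1 = \sum_(mu : {ffun 'I_N -> 'I_c.+1} | interlace lam mu)
    x N ^+ #|yd lam :\: yd (ext0 mu)| * tab_gf (yd (ext0 mu)) N.
Proof.
move=> declam fit lamN; rewrite tab_gf_strip; last exact: yd_row_closed.
rewrite (bigID (fun D' => yd (ext0 (first_rows N D')) == D')) /=.
rewrite [X in _ + X]big1 ?addr0 => [|D' /andP[_]]; last first.
  case: (tab_gf D' N =P 0) => [-> _|/eqP/tab_gf_neq0_yd ->]; first exact: mulr0.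
  by rewrite eqxx.
rewrite (reindex_onto (fun mu => yd (ext0 mu)) (first_rows N)) => [|D' /andP[_ /eqP]] //.
apply: eq_bigl => mu; apply/andP/idP => [[/andP[strip _] /eqP muE]|inter].
  have fit_mu : fits_box r c (ext0 mu) by rewrite -muE; apply: fits_box_first_rows.
  by apply/interlaceP => i _; move/(horizontal_strip_yd declam fit fit_mu): strip; apply.
have fit_mu := fits_box_interlace fit inter.
rewrite first_rows_yd // !eqxx andbT; split=> //.
apply/(horizontal_strip_yd declam fit fit_mu) => i.
case: (ltnP i N) => [|leNi]; first exact: interlaceP inter i.
by rewrite ext0_out // lamN.
Qed.

Lemma card_yd_branch N lam (mu : {ffun 'I_N -> 'I_c.+1}) :
    fits_box r c lam -> interlace lam mu -> (forall i, (N < i)%N -> lam i = 0%N) ->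
  #|yd lam :\: yd (ext0 mu)| = (\sum_(j < N) (lam j - mu j) + lam N)%N.
Proof.
move=> fit inter lamN; have [lamc lamr] := fit.
have [muc _] := fits_box_interlace fit inter.
have sub : yd (ext0 mu) \subset yd lam.
  by apply/subsetP=> p; rewrite !inE => /leq_trans; apply; apply: interlace_le.
rewrite cardsD (setIidPr sub) !card_yd // -sumnB => [|i _]; last exact: interlace_le.
rewrite (@sum_ord_support (fun i => lam i - ext0 mu i)%N r N.+1) => [|i /lamr->|i /lamN->] //.
rewrite big_ord_recr /= ext0_out // subn0; congr (_ + _)%N.
by apply: eq_bigr => j _; rewrite ext0_ord.
Qed.

Lemma alternant_staircase_rec N :
  alternant x N.+1 (staircase N.+1) = \prod_(i < N) (x i - x N) * alternant x N (staircase N).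
Proof.
rewrite (@alternant_branch 0 N _ x (fun=> 0%N)) //; congr (_ * _).
rewrite (big_pred1 [ffun=> ord0]) => [|mu]; last first.
  have -> : mu = [ffun=> ord0] by apply/ffunP=> p; rewrite ffunE ord1.
  by rewrite /= eqxx; apply/forallP=> j; rewrite ffunE.
rewrite big1 // expr0 mul1r; apply: eq_alternant => j ltjN.
by rewrite (ext0_ord _ (Ordinal ltjN)) ffunE.
Qed.

Lemma tab_gf_set0 : tab_gf set0 0 = 1.
Proof.
rewrite /tab_gf (big_pred1 [ffun=> ord0]) ?big_set0 // => T.
have -> : T = [ffun=> ord0] by apply/ffunP=> p; rewrite ffunE ord1.
rewrite /= eqxx; apply/andP; split; last by apply/eqP/setP=> p; rewrite !inE.
by apply/tab_validP; split=> [i j j' _|i i' j _]; rewrite !ffunE.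
Qed.

Lemma tab_bialternant N lam :
    nonincreasing lam -> fits_box r c lam ->
    (forall i, (N <= i)%N -> lam i = 0%N) ->
  alternant x N (staircase N) * tab_gf (yd lam) N =
  alternant x N (fun j => lam j + staircase N j)%N.
Proof.
elim: N lam => [|N IHN] lam declam fit lamN.
  have -> : yd lam = set0 by apply/setP=> p; rewrite !inE lamN.
  by rewrite tab_gf_set0 mulr1 /alternant !det_mx00.
have [lamc _] := fit.
rewrite alternant_staircase_rec (@alternant_branch c) // tab_gf_branch // -mulrA; congr (_ * _).
rewrite mulr_sumr; apply: eq_bigr => mu inter.
rewrite card_yd_branch // mulrCA; congr (_ * _); apply: IHN => [||i]; last exact: ext0_out.
  exact: interlace_nonincreasing inter.
exact: fits_box_interlace inter.
Qed.

End GeneratingFunction.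
End Tableaux.

Lemma fits_box_sorted (l : seq nat) :
  sorted geq l -> fits_box (size l) (head 0%N l) (nth 0%N l).
Proof.
move=> sortl; split=> i; first by rewrite -nth0; apply: nth_sorted_geq.
by move=> lei; rewrite nth_default.
Qed.

Lemma card_cell l : sorted geq l -> #|cell l| = sumn l.
Proof.
move=> sortl; have [lec _] := fits_box_sorted sortl.
rewrite card_sig sumnE (big_nth 0%N) big_mkord -(card_yd (size l) lec).
by apply: eq_card => p; rewrite !inE.
Qed.

Section SchurTableaux.
Variables (l : seq nat) (N : nat).
Hypothesis sortl : sorted geq l.
Local Notation box := ('I_(size l) * 'I_(head 0%N l))%type.
Local Notation diagram := (@yd (size l) (head 0%N l) (nth 0%N l)).
Implicit Types (T : {ffun cell l -> 'I_N}) (U : {ffun box -> 'I_N.+1}).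

Definition ssyt_tab T : {ffun box -> 'I_N.+1} :=
  [ffun p => if insub p is Some q then inord (T q) else ord_max].

Lemma mem_diagram (p : box) : (p \in diagram) = (p.2 < nth 0%N l p.1)%N.
Proof. by rewrite inE. Qed.

Lemma ssyt_tab_cell T q : ssyt_tab T (val q) = T q :> nat.
Proof. by rewrite ffunE valK inordK // ltnW // ltnS ltn_ord. Qed.

Lemma ssyt_tab_Sub T (p : box) (pD : (p.2 < nth 0%N l p.1)%N) :
  ssyt_tab T p = T (Sub p pD) :> nat.
Proof. by rewrite -ssyt_tab_cell SubK. Qed.

Lemma ssyt_tab_out T p : p \notin diagram -> ssyt_tab T p = N :> nat.
Proof. by rewrite mem_diagram => pD; rewrite ffunE insubN. Qed.

Lemma ssyt_tab_inj : injective ssyt_tab.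
Proof.
by move=> T1 T2 eqT; apply/ffunP=> q; apply: ord_inj; rewrite -!ssyt_tab_cell eqT.
Qed.

Lemma ssyt_tab_shape T : tab_shape N (ssyt_tab T) = diagram.
Proof.
apply/setP=> p; rewrite [LHS]inE; case: (boolP (p \in diagram)) => [|pD].
  by rewrite mem_diagram => pD; rewrite ssyt_tab_Sub ltn_ord.
by rewrite ssyt_tab_out // ltnn.
Qed.

Lemma ssyt_tab_valid T : tab_valid (ssyt_tab T) = is_ssyt T.
Proof.
have in_diagram p : (ssyt_tab T p < N)%N -> (p.2 < nth 0%N l p.1)%N.
  by rewrite -mem_diagram -(ssyt_tab_shape T) inE.
apply/tab_validP/forallP => [[rowT colT] p|ssT].
  apply/forallP=> q; case Ep : (val p) => [i j]; case Eq : (val q) => [i' j'].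
  rewrite -!ssyt_tab_cell Ep Eq; apply/andP; split; apply/implyP => /andP[/eqP eq_ij lt_ij].
    by rewrite -eq_ij; apply: rowT.
  by rewrite eq_ij; apply: colT => //; rewrite -Eq ssyt_tab_cell.
split=> [i j j' lej|i i' j lti ltN].
  case: (boolP ((i, j') \in diagram)) => [|/ssyt_tab_out->]; last by rewrite -ltnS.
  rewrite mem_diagram => pD'.
  have pD : ((i, j).2 < nth 0%N l (i, j).1)%N := leq_ltn_trans lej pD'.
  rewrite (ssyt_tab_Sub _ pD) (ssyt_tab_Sub _ pD').
  by have := forallP (ssT (Sub (i, j) pD)) (Sub (i, j') pD'); rewrite /= eqxx lej => /andP[].
have pD' := in_diagram _ ltN.
have pD : ((i, j).2 < nth 0%N l (i, j).1)%N.
  exact: leq_trans pD' (nth_sorted_geq sortl (ltnW lti)).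
rewrite (ssyt_tab_Sub _ pD) (ssyt_tab_Sub _ pD').
by have := forallP (ssT (Sub (i, j) pD)) (Sub (i', j) pD'); rewrite /= eqxx lti => /andP[].
Qed.

Lemma ssyt_tab_onto U : tab_shape N U = diagram -> exists T, U = ssyt_tab T.
Proof.
move=> shU; have UN (q : cell l) : (U (val q) < N)%N.
  by have /setP/(_ (val q)) := shU; rewrite !inE => ->; apply: (valP q).
exists [ffun q => Ordinal (UN q)]; apply/ffunP=> p; apply: ord_inj.
case: (boolP (p \in diagram)) => [|pD].
  rewrite mem_diagram => pD; rewrite -[p](SubK (cell l) pD) ssyt_tab_cell ffunE.
  by [].
rewrite ssyt_tab_out //; move: pD; rewrite -shU inE -leqNgt => leN.
by apply/eqP; rewrite eqn_leq -ltnS ltn_ord.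
Qed.

Lemma schur_tab_gf (K : fieldType) (x : nat -> {mpoly K[N]}) :
  (forall i : 'I_N, x i = 'X_i) -> schur K l N = tab_gf x diagram N.
Proof.
move=> xE; rewrite /tab_gf; transitivity
    (\sum_(U in ssyt_tab @: [set T | is_ssyt T]) \prod_(p in diagram) x (U p)); last first.
  apply: eq_bigl => U; apply/imsetP/andP => [[T + ->]|[validU /eqP shU]].
    by rewrite inE ssyt_tab_valid ssyt_tab_shape.
  have [T UE] := ssyt_tab_onto shU; exists T => //.
  by rewrite inE -ssyt_tab_valid -UE.
rewrite big_imset /=; last by move=> T1 T2 _ _; apply: ssyt_tab_inj.
apply: eq_big => [T|T _]; first by rewrite inE.
rewrite (reindex_omap (fun q : cell l => val q) insub) => [|p]; last first.
  by rewrite mem_diagram => pD; rewrite insubT.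
apply: eq_big => [q|q _]; last by rewrite ssyt_tab_cell xE.
by rewrite mem_diagram (valP q) valK eqxx.
Qed.

End SchurTableaux.

(** * Schur functions *)

Section SchurFunctions.
Variable K : fieldType.
Implicit Types (l : seq nat) (N n : nat).

Definition xvar N (i : nat) : {mpoly K[N]} := oapp (fun k : 'I_N => 'X_k) 0 (insub i).

Lemma xvar_ord N (i : 'I_N) : xvar N i = 'X_i.
Proof. by rewrite /xvar valK. Qed.

Lemma xvar_out N i : (N <= i)%N -> xvar N i = 0.
Proof. by move=> leNi; rewrite /xvar insubF // ltnNge leNi. Qed.

Lemma drop_last_xvar N i : drop_last_var (xvar N.+1 i) = xvar N i.
Proof.
case: (ltnP i N.+1) => [lti|leNi]; last first.
  by rewrite !xvar_out ?(ltnW leNi) // /drop_last_var raddf0.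
rewrite (xvar_ord (Ordinal lti)) /drop_last_var comp_mpolyXU -tnth_nth tnth_mktuple.
case: unliftP => [j|] /(congr1 val) /= ->; last by rewrite xvar_out.
by rewrite /bump leqNgt ltn_ord xvar_ord.
Qed.

Lemma schur_bialternant l N : sorted geq l -> (size l <= N)%N ->
  alternant (xvar N) N (staircase N) * schur K l N =
  alternant (xvar N) N (fun j => nth 0 l j + staircase N j)%N.
Proof.
move=> sortl leN; rewrite (schur_tab_gf sortl (@xvar_ord N)); apply: tab_bialternant.
- by move=> i; apply: nth_sorted_geq.
- exact: fits_box_sorted.
by move=> i lei; rewrite nth_default // (leq_trans leN).
Qed.

Lemma schur_eq0 l N : sorted geq l -> 0%N \notin l -> (N < size l)%N -> schur K l N = 0.
Proof.
move=> sortl l0 ltN; rewrite (schur_tab_gf sortl (@xvar_ord N)).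
have part_gt0 i : (i < size l)%N -> (0 < nth 0 l i)%N.
  by move=> lti; rewrite lt0n; apply: contraNneq l0 => <-; apply: mem_nth.
have head_gt0 : (0 < head 0 l)%N by rewrite -nth0 part_gt0 // (leq_ltn_trans _ ltN).
apply: (@tab_gf_eq0 _ _ _ _ _ _ (Ordinal ltN) (Ordinal head_gt0)) => //.
by rewrite mem_diagram part_gt0.
Qed.

Lemma drop_last_var_schur l N :
  sorted geq l -> drop_last_var (schur K l N.+1) = schur K l N.
Proof.
move=> sortl; rewrite (schur_tab_gf sortl (@xvar_ord N.+1)) (schur_tab_gf sortl (@xvar_ord N)).
rewrite -[RHS]tab_gf_last0; last 3 first.
- exact: yd_row_closed.
- have fit := fits_box_sorted sortl; apply/(horizontal_strip_yd _ fit fit) => i.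
    exact: nth_sorted_geq.
  by rewrite leqnn nth_sorted_geq.
- by rewrite xvar_out.
rewrite /tab_gf /drop_last_var rmorph_sum; apply: eq_bigr => T _.
by rewrite rmorph_prod; apply: eq_bigr => p _; apply: drop_last_xvar.
Qed.

Lemma homog_schur l N : sorted geq l -> schur K l N \is (sumn l).-homog.
Proof.
move=> sortl; apply: rpred_sum => T _.
rewrite mprodXE dhomogX /= mdeg_sum (eq_bigr (fun=> 1%N)) => [|p _]; last exact: mdeg1.
by rewrite sum1_card card_cell.
Qed.

Lemma alternant_xvarE N (v : nat -> nat) : alternant (xvar N) N v =
  \sum_(s : 'S_N) (-1) ^+ s *: 'X_[[multinom v (s i) | i < N]].
Proof.
rewrite /alternant /determinant; apply: eq_bigr => s _.
rewrite -mul_mpolyC rmorphXn rmorphN rmorph1; congr (_ * _).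
rewrite [RHS]mpolyXE_id; apply: eq_bigr => i _.
by rewrite !mxE xvar_ord mnmE.
Qed.

Lemma msym_alternant N (v : nat -> nat) (s : 'S_N) :
  msym s (alternant (xvar N) N v) = (-1) ^+ s * alternant (xvar N) N v.
Proof.
rewrite /alternant -[LHS](det_map_mx (msym s)) -det_perm -det_mulmx -row_permE.
congr (\det _); apply/matrixP=> i j; rewrite !mxE rmorphXn /= !xvar_ord.
by rewrite /msym mmapX mmap1U.
Qed.

Lemma mcoeff_alternant N (v w : nat -> nat) :
    strict_decr N v -> strict_decr N w ->
  (alternant (xvar N) N v)@_[multinom w i | i < N] =
  [forall i : 'I_N, v i == w i]%:R.
Proof.
move=> dv dw; rewrite alternant_xvarE raddf_sum (bigD1 1%g) //= big1 ?addr0; last first.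
  move=> s neq; rewrite mcoeffZ mcoeffX; case: eqP => [/mnmP vw|_]; last by rewrite mulr0.
  case/eqP: neq; apply: perm_increasing => i j ltij; rewrite ltnNge; apply/negP.
  have := dw i j ltij (ltn_ord j); have := vw i; have := vw j; rewrite !mnmE => <- <- ltv.
  rewrite leq_eqVlt => /orP[/eqP sij|/dv]; first by rewrite sij ltnn in ltv.
  by move/(_ (ltn_ord _)); rewrite ltnNge ltnW.
rewrite mcoeffZ mcoeffX odd_perm1 expr0 mul1r; congr (_%:R); congr nat_of_bool.
apply/eqP/forallP => [/mnmP vw i|vw].
  by have := vw i; rewrite !mnmE perm1 => ->.
by apply/mnmP=> i; rewrite !mnmE perm1; apply/eqP/vw.
Qed.

Lemma alternant_staircase_neq0 N : alternant (xvar N) N (staircase N) != 0.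
Proof.
apply/eqP=> /(congr1 (mcoeff [multinom staircase N i | i < N])).
rewrite (mcoeff_alternant (@strict_decr_staircase N) (@strict_decr_staircase N)) mcoeff0.
by rewrite (_ : [forall i, _]) => [/eqP|]; [rewrite oner_eq0|apply/forallP=> i].
Qed.

Lemma schur_sym l N : sorted geq l -> 0%N \notin l -> schur K l N \is symmetric.
Proof.
move=> sortl l0; case: (leqP (size l) N) => [leN|ltN]; last by rewrite schur_eq0 ?rpred0.
apply/issymP=> s; apply: (mulfI (alternant_staircase_neq0 N)).
have sgn0 : (-1) ^+ s != 0 :> {mpoly K[N]} by rewrite signr_eq0.
apply: (mulfI sgn0); rewrite mulrA -msym_alternant -msymM schur_bialternant //.
by rewrite msym_alternant.
Qed.

Lemma homog_symfun_schur n l : is_partn n l -> homog_symfun n (schur K l).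
Proof.
case/and3P=> sortl l0 /eqP <-; split=> N.
- exact: schur_sym.
- exact: homog_schur.
exact: drop_last_var_schur.
Qed.

End SchurFunctions.

(** * Expansions in Schur functions *)

Lemma free_family_in_span (K : fieldType) (V : lmodType K) (I : eqType) (r : seq I)
    (u v : I -> V) (C : I -> I -> K) :
    uniq r ->
    (forall c, \sum_(l <- r) c l *: u l = 0 -> {in r, forall l, c l = 0}) ->
    {in r, forall l, u l = \sum_(k <- r) C l k *: v k} ->
  forall c, exists d, \sum_(k <- r) c k *: v k = \sum_(l <- r) d l *: u l.
Proof.
move=> uniq_r free_u uC c; pose e (i : 'I_(size r)) := tnth (in_tuple r) i.
have sumE (F : I -> V) : \sum_(l <- r) F l = \sum_i F (e i).
  by rewrite [LHS](big_tnth _ _ r).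
pose M := \matrix_(i, j) C (e i) (e j).
have combM (w : 'rV_(size r)) : \sum_i w 0 i *: u (e i) = \sum_j (w *m M) 0 j *: v (e j).
  under [RHS]eq_bigr do rewrite mxE scaler_suml.
  rewrite [RHS]exchange_big; apply: eq_bigr => i _ /=.
  rewrite (uC _ (mem_tnth i (in_tuple r))) sumE scaler_sumr.
  by apply: eq_bigr => j _; rewrite !mxE scalerA.
pose fun_of (w : 'rV[K]_(size r)) l := if insub (index l r) is Some i then w 0 i else 0.
have fun_ofE w i : fun_of w (e i) = w 0 i.
  by rewrite /fun_of /e (tnth_nth (e i)) index_uniq // valK.
have unitM : M \in unitmx.
  rewrite -row_free_unit; apply: inj_row_free => w wM0; apply/rowP=> i.
  rewrite mxE -fun_ofE; apply: free_u; last exact: mem_tnth.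
  rewrite sumE; under eq_bigr do rewrite fun_ofE.
  by rewrite combM wM0 big1 // => j _; rewrite mxE scale0r.
exists (fun_of ((\row_i c (e i)) *m invmx M)); rewrite !sumE.
under [RHS]eq_bigr do rewrite fun_ofE.
by rewrite combM mulmxKV //; apply: eq_bigr => i _; rewrite mxE.
Qed.

Section SchurExpansion.
Variable K : fieldType.
Implicit Types (l : seq nat) (f : varfam K).

Lemma mcoeff_alternant_schur n l l' N :
    is_partn n l -> (size l <= N)%N -> is_partn n l' ->
  (alternant (xvar K N) N (staircase N) * schur K l' N)
    @_[multinom (nth 0 l i + staircase N i)%N | i < N] = (l' == l)%:R.
Proof.
move=> /and3P[sortl l0 _] leN /and3P[sortl' l0' _].
case: (leqP (size l') N) => [leN'|ltN]; last first.
  rewrite schur_eq0 // mulr0 mcoeff0; case: eqP => // ll'.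
  by rewrite ll' ltnNge leN in ltN.
have decr k : sorted geq k -> strict_decr N (fun j => nth 0 k j + staircase N j)%N.
  exact: strict_decr_addn_staircase.
rewrite schur_bialternant // (mcoeff_alternant K (decr _ sortl') (decr _ sortl)).
congr (_%:R); congr nat_of_bool; apply/forallP/eqP => [eql|-> i]; last exact: eqxx.
apply: partn_eq_nth => // i; case: (ltnP i N) => [ltiN|leNi].
  by have := eql (Ordinal ltiN); rewrite /= eqn_add2r => /eqP.
by rewrite !nth_default ?(leq_trans _ leNi).
Qed.

Lemma mcoeff_alternant_schur_sum n c l N : is_partn n l -> (size l <= N)%N ->
  (alternant (xvar K N) N (staircase N) * \sum_(l' <- partns n) c l' *: schur K l' N)
    @_[multinom (nth 0 l i + staircase N i)%N | i < N] = c l.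
Proof.
move=> ln leN; rewrite mulr_sumr raddf_sum /=; under eq_bigr do rewrite -scalerAr mcoeffZ.
by rewrite (sum_partns_delta _ ln) // => l'; apply: mcoeff_alternant_schur.
Qed.

Lemma schur_expansion n f :
  homog_symfun n f -> is_expansion (@schur K) n f (bcoef (@schur K) n f).
Proof.
move=> homf; apply: bcoef_expansion.
have [|l|d fE] := @free_family_in_span K {mpoly K[n]} _ (partns n)
    (fun l => schur K l n) (fun l => hfun K l n) (fun l => bcoef (@hfun K) n (schur K l))
    (partns_uniq n) _ _ (bcoef (@hfun K) n f).
- move=> c c0 l; rewrite mem_partns => ln.
  by rewrite -(mcoeff_alternant_schur_sum c ln (size_partn_le ln)) c0 mulr0 mcoeff0.
- by rewrite mem_partns => ln; apply: (hfun_expansion (homog_symfun_schur K ln)).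
exists d; apply: is_expansion_at => //; first exact: homog_symfun_schur.
by rewrite -fE; apply: hfun_expansion.
Qed.

Lemma eval_ones_schur_row n : eval_ones 1 (schur K (row_partn n)) = 1.
Proof.
have /and3P[sort_row _ _] := is_partn_row n.
have := @schur_bialternant K (row_partn n) 1 sort_row.
rewrite /alternant !det_mx11 !mxE expr0 mul1r /eval_ones => ->; last by case: (n).
by rewrite rmorphXn /= (xvar_ord K (@ord0 0)) mevalXU expr1n.
Qed.

Lemma bcoef_schur_row n f :
  homog_symfun n f -> bcoef (@schur K) n f (row_partn n) = eval_ones 1 f.
Proof.
move=> homf; rewrite [RHS]/eval_ones (schur_expansion homf) rmorph_sum /=.
under eq_bigr do rewrite mevalZ.
rewrite (sum_partns_delta _ (is_partn_row n)) // => l ln; have /and3P[sortl l0 _] := ln.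
rewrite -(size_partn_le1 ln); case: leqP => [|lt1l]; last by rewrite schur_eq0 // meval0.
by rewrite (size_partn_le1 ln) => /eqP->; apply: eval_ones_schur_row.
Qed.

Lemma eval_ones_hfun l : eval_ones 1 (hfun K l) = 1.
Proof.
rewrite /eval_ones rmorph_prod big1 // => k _ /=.
by rewrite hsymE -[LHS]/(eval_ones 1 (Rfun _ k)) eval_ones_Rfun fps_powE expr1.
Qed.

Lemma eval_ones_sum_hfun n f : homog_symfun n f ->
  eval_ones 1 f = \sum_(l <- partns n) bcoef (@hfun K) n f l.
Proof.
move=> homf; rewrite {1}/eval_ones (hfun_expansion homf) rmorph_sum; apply: eq_bigr => l _ /=.
by rewrite mevalZ -[X in _ * X]/(eval_ones 1 (hfun K l)) eval_ones_hfun mulr1.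
Qed.

Lemma mcoeff_mulX_Rfun (a : fps K) n N (m w : 'X_{1..N}) :
    mdeg w = (n + mdeg m)%N ->
  ('X_[m] * Rfun a n N)@_w = \prod_i fps_shift (m i) a (w i).
Proof.
move=> degw; case: (boolP (m <= w)%MM) => [lemw|nle].
  rewrite mulrC -{1}(submK lemw) addmC mcoeffMX mcoeff_Rfun ifT.
    by apply: eq_bigr => i _; rewrite /fps_shift (mnm_lepP lemw) mnmE.
  by rewrite -(eqn_add2r (mdeg m)) -mdegD submK // degw.
rewrite [RHS](_ : _ = 0).
  apply/eqP; rewrite mulrC mcoeff_eq0 (perm_mem (msuppMX _ _)); apply: contra nle.
  by case/mapP=> m' _ ->; rewrite lem_addr.
have /existsP[i nle_i] : [exists i, ~~ (m i <= w i)%N].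
  by rewrite -negb_forall; apply: contra nle => /forallP lemw; apply/mnm_lepP.
by rewrite (bigD1 i) //= /fps_shift (negPf nle_i) mul0r.
Qed.

Lemma jacobi_trudi_Rfun (a : fps K) n l N : a 0%N = 1 -> is_partn n l -> (size l <= N)%N ->
  bcoef (@schur K) n (Rfun a n) l =
  \det (\matrix_(i < N, j < N) fps_shift i a (nth 0 l i + j)%N).
Proof.
move=> a0 ln leN; rewrite -(mcoeff_alternant_schur_sum _ ln leN).
rewrite -(schur_expansion (homog_symfun_Rfun n a0)) alternant_xvarE mulr_suml raddf_sum.
rewrite /determinant; apply: eq_bigr => s _ /=; rewrite -scalerAl mcoeffZ; congr (_ * _).
have /and3P[_ _ /eqP suml] := ln; rewrite mcoeff_mulX_Rfun.
  apply: eq_bigr => i _; rewrite !mxE !mnmE.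
  have [lti lts] := (ltn_ord i, ltn_ord (s i)).
  rewrite /fps_shift /staircase.
  have -> : (N.-1 - s i <= nth 0 l i + (N.-1 - i))%N = (i <= nth 0 l i + s i)%N by lia.
  by case: ifP => // le_i; congr a; lia.
rewrite !mdegE -suml sumnE (big_nth 0%N) big_mkord (@sum_ord_support (nth 0%N l) (size l) N).
- rewrite [X in (_ + X)%N](_ : _ = \sum_(i < N) staircase N i)%N; last first.
    by rewrite [RHS](reindex_inj (@perm_inj _ s)); apply: eq_bigr => i _; rewrite mnmE.
  by rewrite -big_split; apply: eq_bigr => i _; rewrite mnmE.
- by move=> i lei; rewrite nth_default.
by move=> i lei; rewrite nth_default // (leq_trans leN).
Qed.

End SchurExpansion.

(** * Hooks *)

Section Hooks.
Variables (K : fieldType) (a : fps K).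
Hypothesis a0 : a 0%N = 1.

(* The Jacobi-Trudi matrix of the hook (m, 1^k). *)
Definition hook_entry m i j : K := fps_shift i a ((if i == 0%N then m else 1) + j)%N.

Definition hook_det m k : K := \det (\matrix_(i < k.+1, j < k.+1) hook_entry m i j).

Lemma hook_entry0 m j : hook_entry m 0 j = a (m + j)%N.
Proof. exact: fps_shift0. Qed.

Lemma hook_entryS m i j : hook_entry m i.+1 j = fps_shift i a j.
Proof. exact: fps_shiftSS. Qed.

Lemma hook_det0 m : hook_det m 0 = a m.
Proof. by rewrite /hook_det det_mx11 mxE hook_entry0 addn0. Qed.

Lemma hook_detS m k : hook_det m k.+1 = a m * hook_det 1 k - hook_det m.+1 k.
Proof.
rewrite {1}/hook_det (expand_det_col _ ord0) !big_ord_recl big1 => [|i _]; last first.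
  by rewrite mxE !lift0 hook_entryS mul0r.
rewrite addr0 !mxE lift0 hook_entry0 hook_entryS addn0 fps_shift0 a0 mul1r.
rewrite /cofactor /= /bump /= addn0 expr0 mul1r expr1 mulN1r; congr (a m * _ - _).
  congr (\det _); apply/matrixP=> i j; rewrite !mxE !lift0 hook_entryS.
  by case: (i : nat) => [|i']; rewrite ?hook_entry0 ?hook_entryS ?fps_shift0 ?add1n.
congr (\det _); apply/matrixP=> i j; rewrite !mxE !lift0 /=.
by case: (i : nat) => [|i'] /=; rewrite ?hook_entry0 ?addnS ?addSn.
Qed.

Definition column_det n : K := if n is k.+1 then hook_det 1 k else 1.

Lemma mul_column_det m k : a m * column_det k.+1 = hook_det m k.+1 + hook_det m.+1 k.
Proof. by rewrite hook_detS subrK. Qed.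

Lemma column_det_inv : column_det = fps_inv (fps_dil (-1) a).
Proof.
apply: fps_inv_unique; first by rewrite coef0_fps_dil.
apply: funext => -[|n]; first by rewrite coef0_fpsM coef0_fps_dil a0 mulr1.
pose G i := (-1) ^+ i * hook_det i (n.+1 - i).
have hook00 : hook_det 0 n.+1 = 0 by rewrite hook_detS a0 mul1r subrr.
rewrite coef_fpsM big_ord_recr /= subnn mulr1.
rewrite (eq_bigr (fun i : 'I_n.+1 => - (G i.+1 - G i))) => [|i _].
  rewrite sumrN -(big_mkord xpredT (fun i => G i.+1 - G i)) telescope_sumr //.
  by rewrite /G /fps_dil subnn hook_det0 subn0 hook00 mulr0 subr0 addNr.
have lti := ltn_ord i; rewrite /fps_dil /G -mulrA subSS.
have -> : (n.+1 - i = (n - i).+1)%N by lia.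
by rewrite mul_column_det exprS; ring.
Qed.

Lemma sum_mul_column_det n : (0 < n)%N ->
  \poly_(j < n.+1) (a (n - j)%N * column_det j) =
  (1 + 'X) * \sum_(k < n) hook_det (n - k) k *: 'X^k.
Proof.
case: n => // n _; have hook00 : hook_det 0 n.+1 = 0 by rewrite hook_detS a0 mul1r subrr.
rewrite poly_def mulrDl mul1r.
transitivity (\sum_(j < n.+2) hook_det (n.+1 - j) j *: 'X^j
              + \sum_(j < n.+1) hook_det (n.+1 - j) j *: 'X^(j.+1) : {poly K}).
  rewrite !(big_ord_recl n.+1) /= subn0 hook_det0 mulr1 -addrA; congr (_ + _).
  rewrite -big_split; apply: eq_bigr => j _ /=.
  by rewrite /bump /= add1n subSS subSn ?leq_ord // -scalerDl mul_column_det.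
rewrite big_ord_recr /= subnn hook00 scale0r addr0; congr (_ + _).
by rewrite mulr_sumr; apply: eq_bigr => j _; rewrite -scalerAr exprS.
Qed.

Lemma bcoef_schur_hook n k : (k < n)%N ->
  bcoef (@schur K) n (Rfun a n) ((n - k)%N :: nseq k 1%N) = hook_det (n - k) k.
Proof.
move=> ltkn; rewrite (jacobi_trudi_Rfun (N := k.+1) a0 (is_partn_hook ltkn)) /= ?size_nseq //.
congr (\det _); apply/matrixP=> i j; rewrite !mxE /hook_entry.
have -> // : nth 0%N ((n - k)%N :: nseq k 1%N) i = if i == 0%N :> nat then (n - k)%N else 1%N.
by case: i => -[|i] //= ltik; rewrite nth_nseq -ltnS ltik.
Qed.

Lemma bcoef_schur_column n :
  bcoef (@schur K) n (Rfun a n) (nseq n 1%N) = fps_inv (fps_dil (-1) a) n.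
Proof.
rewrite -column_det_inv; case: n => [|n]; last first.
  by have := bcoef_schur_hook (ltnSn n); rewrite subSnn.
rewrite (bcoef_schur_row (homog_symfun_Rfun 0 a0)) eval_ones_Rfun fps_powE expr1.
exact: a0.
Qed.

Lemma coef_mul_inv_dil_polyC n :
  (fps_map polyC a * fps_inv (fps_dil (- 'X) (fps_map polyC a))) n =
  \poly_(j < n.+1) (a (n - j)%N * fps_inv (fps_dil (-1) a) j).
Proof.
have dil0 : fps_dil (-1) a 0%N = 1 by rewrite coef0_fps_dil.
have map_dil0 : fps_map polyC (fps_dil (-1) a) 0%N = 1 by rewrite /fps_map dil0.
have -> : fps_dil (- 'X) (fps_map polyC a) = fps_dil 'X (fps_map polyC (fps_dil (-1) a)).
  by rewrite fps_map_dil /= fps_dil_dil rmorphN1 mulrN1.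
have -> : fps_inv (fps_dil 'X (fps_map polyC (fps_dil (-1) a))) =
    fps_dil 'X (fps_map polyC (fps_inv (fps_dil (-1) a))).
  by rewrite rmorph_fps_inv //= rmorph_fps_inv //= coef0_fps_dil.
rewrite mulrC coef_fpsM poly_def; apply: eq_bigr => j _.
by rewrite /fps_dil /fps_map -!mul_polyC polyCM; ring.
Qed.

Lemma hook_generating_polynomial n : (0 < n)%N ->
  let P := (fps_map polyC a * fps_inv (fps_dil (- 'X) (fps_map polyC a))) n in
  [/\ (size P <= n.+1)%N, 1 + 'X %| P
    & P %/ (1 + 'X) =
      \sum_(k < n) bcoef (@schur K) n (Rfun a n) ((n - k)%N :: nseq k 1%N) *: 'X^k].
Proof.
move=> n_gt0 P; have PE : P = (1 + 'X) * \sum_(k < n) hook_det (n - k) k *: 'X^k.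
  by rewrite -sum_mul_column_det // column_det_inv -coef_mul_inv_dil_polyC.
have X1_neq0 : 1 + 'X != 0 :> {poly K} by rewrite addrC -size_poly_gt0 size_XaddC.
split; first by rewrite /P coef_mul_inv_dil_polyC size_poly.
  by rewrite PE dvdp_mulr.
by rewrite PE mulKp //; apply: eq_bigr => k _; rewrite bcoef_schur_hook.
Qed.

End Hooks.

Theorem theorem2p7 (K : fieldType) (charK0 : [pchar K] =i pred0)
    (a : fps K) (a0 : a 0%N = 1)
    (b : nat -> K) (logF : forall n, (0 < n)%N -> fps_log a n = b n / n%:R) :
  let R := Rfun a in
  (* (a) *)
  [/\ (forall n, bcoef (@schur K) n (R n) (row_partn n) = a n) /\
      (forall n (f : varfam K), homog_symfun n f ->
         bcoef (@schur K) n f (row_partn n) = \sum_(l <- partns n) bcoef (@hfun K) n f l),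
  (* (b) *)
      forall n, bcoef (@schur K) n (R n) (nseq n 1%N) =
                fps_inv (fps_dil (-1) a) n,
  (* (c) *)
      [/\ forall k, (0 < k)%N -> forall n,
            bcoef (@hfun K) (k * n) (R (k * n)%N) (nseq n k) =
            fps_exp (fps_opp (fps_dil (-1) (fps_logser (fun i => b (k * i)%N)))) n,
          forall k, (0 < k)%N -> forall n,
            bcoef (@hfun K) (k * n) (R (k * n)%N) (nseq n k) =
            fps_inv (fps_dil (-1) (fps_exp (fps_logser (fun i => b (k * i)%N)))) n
        & forall n, (0 < n)%N -> bcoef (@hfun K) n (R n) [:: n] = b n],
  (* (d) *)
      forall i j n, (0 < i)%N -> (0 < j)%N -> (i + j)%N = n ->
        bcoef (@hfun K) n (R n) [:: maxn i j; minn i j] =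
        if i == j then (b i ^+ 2 - b n) / 2%:R else b i * b j - b n
    & (* (e) *)
      (forall k n, eval_ones k (R n) = fps_pow a k n) /\
  (* (f) *)
      (let P : fps {poly K} :=
         fps_mul (fun m => (a m)%:P) (fps_inv (fps_dil (- 'X) (fun m => (a m)%:P))) in
       forall n, (0 < n)%N ->
         [/\ (size (P n) <= n.+1)%N,
             (1 + 'X %| P n)%R
           & P n %/ (1 + 'X) =
             \sum_(k < n) bcoef (@schur K) n (R n) ((n - k)%N :: nseq k 1%N) *: 'X^k])].
Proof.
move=> R; have homR n : homog_symfun n (R n) := homog_symfun_Rfun n a0.
pose c : fps K := fps_theta (fps_log a).
have ac : fps_logder a c := fps_logder_log charK0 a0.
have cE n : (0 < n)%N -> c n = b n.
  by case: n => // n _; rewrite /c /fps_theta logF // mulrC divfK ?natS_neq0.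
have rect_coef k n : (0 < k)%N -> bcoef (@hfun K) (k * n) (R (k * n)%N) (nseq n k) =
    fps_exp (fps_opp (fps_dil (-1) (fps_logser (fun i => b (k * i)%N)))) n.
  move=> k_gt0; rewrite (bcoef_hfun_rect charK0 a0 ac) //.
  congr (fps_exp (- fps_dil _ _) n); apply: funext => -[|i] //=.
  by rewrite cE // muln_gt0 k_gt0.
split.
- split=> [n|n f homf]; rewrite bcoef_schur_row //; last exact: eval_ones_sum_hfun.
  by rewrite eval_ones_Rfun fps_powE.
- exact: bcoef_schur_column.
- split=> [k k_gt0 n|k k_gt0 n|n n_gt0]; first exact: rect_coef.
    by rewrite rect_coef // fps_inv_dil_exp.
  by rewrite (bcoef_hfun_row charK0 a0 ac) // cE.
- move=> i j _ i_gt0 j_gt0 <-; rewrite (bcoef_hfun_two charK0 a0 ac) // !cE //.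
  by rewrite addn_gt0 i_gt0.
by split=> [k n|P n]; [apply: eval_ones_Rfun|apply: hook_generating_polynomial].
Qed.
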